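(* Let $1<p,q<+\infty$. (a) If $p>q$, then $RM(p,q)\subsetneq H^{q,p}$ (proper inclusion). (b) If $q>p$, then $H^{q,p}\subsetneq RM(p,q)$ (proper inclusion).
   Context: Let $\mathbb{D}=\{z\in\mathbb{C}:|z|<1\}$ be the open unit disc and $\mathcal{H}(\mathbb{D})$ the space of holomorphic functions $f:\mathbb{D}\to\mathbb{C}$. For $1\le p,q<+\infty$ define $$\rho_{p,q}(f)=\left(\frac{1}{2\pi}\int_{0}^{2\pi}\left(\int_{0}^{1}|f(re^{it})|^{p}\,dr\right)^{q/p}dt\right)^{1/q},\qquad RM(p,q)=\{f\in\mathcal{H}(\mathbb{D}):\rho_{p,q}(f)<+\infty\},$$ and $$\|f\|_{H^{q,p}}=\left(\int_{0}^{1}\left(\int_{0}^{2\pi}|f(re^{i\theta})|^{q}\,\frac{d\theta}{2\pi}\right)^{p/q}dr\right)^{1/p},\qquad H^{q,p}=\{f\in\mathcal{H}(\mathbb{D}):\|f\|_{H^{q,p}}<+\infty\}.$$ The measure $dr$ is Lebesgue measure on $[0,1]$. In $RM(p,q)$ the first index $p$ is the radial exponent and the second index $q$ the angular exponent; in $H^{q,p}$ the first index $q$ is the angular exponent and the second index $p$ the radial exponent. *)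

(* Defs.v *)
From HB Require Import structures.
From mathcomp Require Import all_boot all_order all_algebra.
From mathcomp Require Import complex.
From mathcomp Require Import all_classical all_reals all_analysis.

Set Implicit Arguments.
Unset Strict Implicit.
Unset Printing Implicit Defensive.

Import Order.TTheory GRing.Theory Num.Theory.
Import numFieldNormedType.Exports.

Local Open Scope classical_set_scope.
Local Open Scope complex_scope.
Local Open Scope ring_scope.

Section mixed_norm_spaces.
Context {R : realType}.
Implicit Types (f : R[i] -> R[i]) (p q r t : R).

Definition unit_disc : set R[i] := [set z | Normc.normc z < 1].

Definition polar r t : R[i] := (r * cos t) +i* (r * sin t).

(* A function on the disc is represented by a total function on the plane,
   whose values outside the disc are irrelevant. The direction 1 makes
   derivable the existence of the complex derivative: R[i]^o is R[i] as a
   normed module over itself, so the increment ranges over R[i]. *)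
Definition holomorphic_disc : set (R[i] -> R[i]) :=
  [set f | forall z, unit_disc z ->
     derivable (f : R[i]^o -> R[i]^o) z 1].

(* The radial integrals range over [0, 1[ because f is only given on the open
   disc. The norms take values in \bar R, where +oo `^ a = +oo for a > 0. *)
Definition rho p q f : \bar R :=
  (((2 * pi)^-1%:E * \int[lebesgue_measure]_(t in `[0%R, (2 * pi)%R])
     (\int[lebesgue_measure]_(r in `[0%R, 1%R[)
        (Normc.normc (f (polar r t)) `^ p)%:E) `^ (q / p)) `^ q^-1)%E.

Definition RM p q : set (R[i] -> R[i]) :=
  [set f | holomorphic_disc f /\ (rho p q f < +oo)%E].

Definition Hnorm q p f : \bar R :=
  ((\int[lebesgue_measure]_(r in `[0%R, 1%R[)
     (\int[lebesgue_measure]_(t in `[0%R, (2 * pi)%R])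
        (Normc.normc (f (polar r t)) `^ q / (2 * pi))%:E) `^ (p / q))
   `^ p^-1)%E.

Definition Hmixed q p : set (R[i] -> R[i]) :=
  [set f | holomorphic_disc f /\ (Hnorm q p f < +oo)%E].

End mixed_norm_spaces.

(* Main.v *)
(** The inclusions are Minkowski's integral inequality: for [s = p / q > 1] (or
    [s = q / p]) and [g >= 0], the [L^s] norm of [\int g(., y) dy] is at most
    the integral of the [L^s] norms of the [g(., y)].

    For properness take [f(z) = (1 - z)^-a (c - log (1 - z))^-b] with
    [a = 1/p + 1/q] and [c] large.  Writing [u = 1 - r] and [tau] for the
    distance from [t] to [2 pi Z], [|f(r e^it)|] is comparable to
    [phi(u + tau)], where [phi(s) = s^-a (c - ln s)^-b], so the two norms differ
    only in the order of integration.  Integrating [phi^m] in the inner variable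
    and raising to the power [M / m], where [m] and [M] are the inner and outer
    exponents, leaves [x^-1 (c - ln x)^(- b M)] in the outer variable [x], which
    is integrable at [0] exactly when [b M > 1].  With [b = 1 / min(p, q)] the
    norm whose outer exponent is the larger one is finite and the other norm is
    infinite. *)

Require Import Defs.
From mathcomp Require Import all_boot all_order all_algebra.
From mathcomp Require Import complex.
From mathcomp Require Import all_classical all_reals all_analysis.
From mathcomp Require Import measurable_realfun.
From mathcomp Require Import ring lra.

Set Implicit Arguments.
Unset Strict Implicit.
Unset Printing Implicit Defensive.

Import Order.TTheory GRing.Theory Num.Theory.
Import numFieldNormedType.Exports.

Local Open Scope classical_set_scope.
Local Open Scope ring_scope.

(** A pure power (1 - z)^-a cannot separate the spaces: both norms are finite exactly when a < 1/p +
    1/q. At the critical a both orders of integration leave x^-1, and the logarithmic factor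
    decides. Only one-sided estimates of the inner integral are proved, so constants may be lost
    freely; c has to be large because the kernel, and a factor split off from it, must be
    nonincreasing on the whole range of s and not only near 0. The inclusions meet a different
    obstacle: [f] is arbitrary off the open disc, so |f(r e^it)| is known to be measurable in (r, t)
    only for r in [0, 1[, where this follows from continuity in each variable, and Minkowski is
    applied to its extension by 0. In the estimates for the extremal function, measurability of the
    inner integrals is bypassed by a monotonicity lemma that does not ask for it. Complex powers are
    taken through a logarithm assembled from [ln] and [atan]; its derivative comes from that of the
    exponential. *)

(** * Minkowski's integral inequality *)

Section minkowski_integral.
Context d1 d2 (T1 : measurableType d1) (T2 : measurableType d2) (R : realType).
Variables (m1 : {sigma_finite_measure set T1 -> \bar R})
          (m2 : {sigma_finite_measure set T2 -> \bar R}).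
Local Open Scope ereal_scope.

(** Write h^s as h^(s-1) h for the inner integral h, exchange the integrals, apply Hoelder in x for
    each y, and divide by (integral of h^s)^(1 - 1/s). The division requires this factor to be
    finite, so h is first cut off at height n; the finite measure of [D] then makes the cut-off
    integrable. *)
Lemma minkowski_integral (D : set T1) (g : T1 * T2 -> R) (s : R) :
  (1 < s)%R -> measurable D -> m1 D < +oo -> measurable_fun setT g ->
  (forall z, 0 <= g z)%R -> (forall z, ~ D z.1 -> g z = 0%R) ->
  \int[m1]_x (\int[m2]_y (g (x, y))%:E) `^ s <=
  (\int[m2]_y (\int[m1]_x (g (x, y) `^ s)%:E) `^ s^-1) `^ s.
Proof.
move=> s1 mD fD mg g0 gD.
have s0 : (0 < s)%R by exact: lt_trans s1.
have sn0 : s != 0%R by rewrite gt_eqF.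
pose h x := \int[m2]_y (g (x, y))%:E.
have h0 x : 0 <= h x by apply: integral_ge0 => y _; rewrite lee_fin.
have mgE : measurable_fun setT (fun z => (g z)%:E) by exact/measurable_EFinP.
have mh : measurable_fun setT h.
  by apply: (measurable_fun_fubini_tonelli_F (fun z => (g z)%:E)) => // z; rewrite lee_fin.
have mg1 y : measurable_fun setT (fun x => g (x, y)).
  by apply: (measurableT_comp mg); exact: measurable_pair2.
have mg2 x : measurable_fun setT (fun y => g (x, y)).
  by apply: (measurableT_comp mg); exact: measurable_pair1.
pose hn n x := fine (mine (h x) n%:R%:E).
have hnE n x : (hn n x)%:E = mine (h x) n%:R%:E.
  rewrite /hn fineK// ge0_fin_numE; last by rewrite le_min h0 lee_fin ler0n.
  by rewrite gt_min ltry orbT.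
have hn0 n x : (0 <= hn n x)%R by rewrite -lee_fin hnE le_min h0 lee_fin ler0n.
have hnn n x : (hn n x <= n%:R)%R by rewrite -lee_fin hnE ge_min lexx orbT.
have hnh n x : (hn n x)%:E <= h x by rewrite hnE ge_min lexx.
have mhn n : measurable_fun setT (hn n).
  apply: (measurableT_comp (@fine_measurable R setT measurableT)) => //.
  exact: measurable_mine.
have hD x : ~ D x -> h x = 0.
  by move=> Dx; rewrite /h; apply: integral0_eq => y _; rewrite gD.
pose A n := \int[m1]_x (hn n x `^ s)%:E.
pose N y := (\int[m1]_x (g (x, y) `^ s)%:E) `^ s^-1.
pose B := \int[m2]_y N y.
have B0 : 0 <= B by apply: integral_ge0 => y _; exact: poweR_ge0.
have A0 n : 0 <= A n by apply: integral_ge0 => x _; rewrite lee_fin powR_ge0.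
have mA n : measurable_fun setT (fun x => (hn n x `^ s)%:E).
  by apply/measurable_EFinP; apply: (measurableT_comp (measurable_powR s)).
have Afin n : A n < +oo.
  apply: (@le_lt_trans _ _ (\int[m1]_x ((n%:R `^ s) * \1_D x)%:E)).
    apply: ge0_le_integral => //.
    - by move=> x _; rewrite lee_fin powR_ge0.
    - by apply/measurable_EFinP; apply: measurable_funM => //; exact: measurable_indic.
    - move=> x _; rewrite lee_fin indicE.
      have [xD|xD] := boolP (x \in D).
        by rewrite mulr1 ge0_ler_powR// ?nnegrE ?ler0n// ltW.
      have hx : hn n x = 0%R.
        apply/eqP; rewrite eq_le hn0 andbT -lee_fin (le_trans (hnh n x))//.
        by rewrite hD// => /mem_set; exact/negP.
      by rewrite hx powR0// mulr0.
  under eq_integral do rewrite EFinM.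
  rewrite ge0_integralZl ?lee_fin ?powR_ge0//; last first.
    by apply/measurable_EFinP; exact: measurable_indic.
  by rewrite integral_indic// setIT lte_mul_pinfty// lee_fin powR_ge0.
(* The Hoelder conjugate of [s]: since (s - 1) s' = s, the L^s' norm of the power s - 1 of [hn n] is
   again a power of [A n]. *)
pose s' := (s / (s - 1))%R.
have s'0 : (0 < s')%R by rewrite divr_gt0// subr_gt0.
have ss' : (s'^-1 + s^-1 = 1)%R.
  rewrite /s' invf_div -{2}[(s^-1)%R]mul1r -mulrDl subrK divff//.
have mhs n : measurable_fun setT (fun x => hn n x `^ (s - 1))%R.
  by apply: (measurableT_comp (measurable_powR _)).
have AB n : A n <= A n `^ s'^-1 * B.
  have step : A n <= \int[m1]_x \int[m2]_y (hn n x `^ (s - 1) * g (x, y))%:E.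
    have -> : \int[m1]_x \int[m2]_y (hn n x `^ (s - 1) * g (x, y))%:E =
      \int[m1]_x ((hn n x `^ (s - 1))%:E * h x).
      apply: eq_integral => x _.
      under eq_integral do rewrite EFinM.
      rewrite ge0_integralZl ?lee_fin ?powR_ge0//.
        exact/measurable_EFinP.
      by move=> y _; rewrite lee_fin.
    rewrite /A; apply: ge0_le_integral => //.
    - by move=> x _; rewrite lee_fin powR_ge0.
    - by apply: emeasurable_funM => //; exact/measurable_EFinP.
    - move=> x _; have -> : (hn n x `^ s = hn n x `^ (s - 1) * hn n x)%R.
        have [->|hx] := eqVneq (hn n x) 0%R; first by rewrite mulr0 powR0.
        rewrite -{3}[hn n x]powRr1// -powRD ?subrK//.
        by rewrite hx implybT.
      by rewrite EFinM lee_wpmul2l// lee_fin powR_ge0.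
  apply: (le_trans step).
  have mF : measurable_fun setT
      (fun z => (hn n z.1 `^ (s - 1) * g z)%:E).
    apply/measurable_EFinP; apply: measurable_funM => //.
    exact: (measurableT_comp (mhs n) (measurable_fst)).
  rewrite (@fubini_tonelli _ _ _ _ _ m1 m2
    (fun z => (hn n z.1 `^ (s - 1) * g z)%:E))//; last first.
    by move=> z; rewrite lee_fin mulr_ge0// powR_ge0.
  have mN : measurable_fun setT N.
    apply: (measurableT_comp (measurable_poweR _)).
    apply: (measurable_fun_fubini_tonelli_G (fun z => (g z `^ s)%:E)).
      apply/measurable_EFinP; exact: (measurableT_comp (measurable_powR _)).
    by move=> z; rewrite lee_fin powR_ge0.
  rewrite -ge0_integralZl//; last 2 first.
    - by move=> y _; exact: poweR_ge0.
    - exact: poweR_ge0.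
  apply: ge0_le_integral => //.
  - by move=> y _; apply: integral_ge0 => x _; rewrite lee_fin mulr_ge0// powR_ge0.
  - by apply: (measurable_fun_fubini_tonelli_G
      (fun z => (hn n z.1 `^ (s - 1) * g z)%:E)) => // z;
      rewrite lee_fin mulr_ge0// powR_ge0.
  - exact: emeasurable_funM.
  - move=> y _.
    have := hoelder m1 (mhs n) (mg1 y) s'0 s0 ss'.
    rewrite Lnorm1 !unlock /=.
    have -> : \int[m1]_x `|(hn n x `^ (s - 1) * g (x, y))%:E| =
      \int[m1]_x (hn n x `^ (s - 1) * g (x, y))%:E.
      by apply: eq_integral => x _; rewrite gee0_abs// lee_fin mulr_ge0// powR_ge0.
    have -> : \int[m1]_x `|(hn n x `^ (s - 1))%:E| `^ s' = A n.
      apply: eq_integral => x _; rewrite gee0_abs ?lee_fin ?powR_ge0//.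
      rewrite poweR_EFin -powRrM /s' mulrCA divff ?mulr1//.
      by rewrite gt_eqF// subr_gt0.
    have -> : \int[m1]_x `|(g (x, y))%:E| `^ s = \int[m1]_x (g (x, y) `^ s)%:E.
      by apply: eq_integral => x _; rewrite gee0_abs ?lee_fin// poweR_EFin.
    by [].
have ABs n : A n <= B `^ s.
  have [By|By] := eqVneq B +oo; first by rewrite By poweRyr// leey.
  have Bfin : B \is a fin_num by rewrite ge0_fin_numE// ltey.
  have Anfin : A n \is a fin_num by rewrite ge0_fin_numE.
  move: (AB n) (A0 n) (B0); rewrite -(fineK Bfin) -(fineK Anfin).
  move: (fine (A n)) (fine B) => a b; rewrite !poweR_EFin -EFinM !lee_fin.
  move=> ab a0 b0; have [->|an0] := eqVneq a 0%R; first exact: powR_ge0.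
  have a1 : (a `^ s^-1 <= b)%R.
    rewrite -(@ler_pM2l _ (a `^ s'^-1)); last by rewrite powR_gt0// lt_neqAle eq_sym an0.
    by rewrite -powRD ?ss' ?powRr1// an0 implybT.
  rewrite -[a]powRr1// -(mulVf sn0) powRrM.
  by rewrite ge0_ler_powR// ?nnegrE// ?powR_ge0// ltW.
have cvA : A n @[n --> \oo] --> \int[m1]_x (h x) `^ s.
  have -> : \int[m1]_x (h x) `^ s = \int[m1]_x limn (fun n => (hn n x `^ s)%:E).
    apply: eq_integral => x _; apply/esym/cvg_lim => //.
    have [hy|hy] := eqVneq (h x) +oo.
      rewrite hy poweRyr//; apply/cvgeryP/cvgryPge => M; near=> n.
      have -> : hn n x = n%:R by rewrite /hn hy /mine ltNge leey.
      have n1 : (1 <= n%:R :> R)%R by rewrite ler1n; near: n; exact: nbhs_infty_gt.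
      apply: (@le_trans _ _ n%:R).
        by near: n; exact: nbhs_infty_ger.
      by rewrite -{1}[n%:R]powRr1 ?ler0n// ler_powR// ltW.
    have hfin : h x \is a fin_num by rewrite ge0_fin_numE// ltey.
    apply: cvg_near_cst; near=> n.
    rewrite -poweR_EFin hnE min_l// -(fineK hfin) lee_fin.
    by near: n; exact: nbhs_infty_ger.
  apply: cvg_monotone_convergence => //.
  - by move=> n x _; rewrite lee_fin powR_ge0.
  - move=> x _ n k nk; rewrite lee_fin ge0_ler_powR// ?nnegrE//; first exact: ltW.
    rewrite -lee_fin !hnE le_min ge_min lexx /= ge_min lee_fin ler_nat nk orbT//.
rewrite -(cvg_lim _ cvA)//.
by apply: lime_le; [apply/cvg_ex; eexists; exact: cvA|exact: nearW].
Unshelve. all: by end_near. Qed.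

End minkowski_integral.

(** * Joint measurability of |f(r e^it)| *)

(** Round r down to the grid of mesh 1/(n+1). The rounded function is measurable because it does not
    depend on r within each of countably many strips, and it converges to [F] by continuity in r.
    Rounding down keeps the grid point in [0, 1[, where the hypotheses hold. *)
Lemma measurable_fun_caratheodory d (T : measurableType d) (R : realType)
    (F : R * T -> R) (D : set T) : measurable D ->
  (forall r, 0 <= r < 1 -> measurable_fun D (fun t => F (r, t))) ->
  (forall r t, 0 <= r < 1 -> D t -> {for r, continuous (fun r => F (r, t))}) ->
  measurable_fun (([set` `[0, 1[] : set R) `*` D) F.
Proof.
move=> mD mF cF.
pose s (n : nat) (r : R) : R := (Num.trunc (n.+1%:R * r))%:R / n.+1%:R.
have N0 (n : nat) : 0 < n.+1%:R :> R by rewrite ltr0n.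
have s_itv n r : 0 <= r -> s n r <= r < s n r + n.+1%:R^-1.
  move=> r0; rewrite /s -[X in _ + X]mul1r -mulrDl ler_pdivrMr// ltr_pdivlMr//.
  by rewrite (mulrC r) natr1 trunc_itv// mulr_ge0.
have s01 n r : 0 <= r < 1 -> 0 <= s n r < 1.
  move=> /andP[r0 r1]; have /andP[sr _] := s_itv n r r0.
  by rewrite (le_lt_trans sr r1) andbT divr_ge0.
apply: (@measurable_fun_cvg _ _ _ _ (fun n z => F (s n z.1, z.2))); last first.
  move=> [r t] [/= r01 Dt]; rewrite in_itv/= in r01.
  apply: (@cvg_comp _ _ _ (fun n => s n r) (fun r => F (r, t)) _ (nbhs r));
    last exact: cF.
  apply/cvgrPdist_lt => e e0; near=> n.
  have /andP[sr rs] := s_itv n r (andP r01).1.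
  rewrite ger0_norm ?subr_ge0// ltrBlDl (lt_le_trans rs)// lerD2l.
  rewrite ltW//; near: n; exact: near_infty_natSinv_lt (PosNum e0).
move=> n _ B mB.
have -> : ([set` `[0, 1[] `*` D) `&` (fun z => F (s n z.1, z.2)) @^-1` B =
  \bigcup_k (([set` `[k%:R / n.+1%:R, k.+1%:R / n.+1%:R[] `&` [set` `[0, 1[]) `*`
    (D `&` (fun t => F (k%:R / n.+1%:R, t)) @^-1` B)).
  apply/seteqP; split=> [[r t] [[/= r01 Dt] Bt]|[r t] [k _] [[/= rk r01] [Dt Bt]]].
    exists (Num.trunc (n.+1%:R * r)) => //; split=> //=; split=> //.
    move: r01; rewrite /= !in_itv/= => /andP[r0 _].
    by rewrite -(natr1 (Num.trunc _)) mulrDl mul1r; exact: s_itv.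
  split=> //=; rewrite /s.
  suff -> : Num.trunc (n.+1%:R * r) = k by [].
  move: r01 rk; rewrite /= !in_itv/= => /andP[r0 _].
  rewrite ler_pdivrMr// ltr_pdivlMr// => rk.
  by apply: truncn_def; rewrite mulrC.
apply: bigcup_measurable => k _.
(* Only k <= n gives a grid point in [0, 1[; the remaining strips do not meet [0, 1[. *)
have [kn|kn] := ltnP k n.+1.
  apply: measurableX; first by apply: measurableI.
  apply: mF => //.
  by rewrite divr_ge0//= ltr_pdivrMr// mul1r ltr_nat.
suff -> : [set` `[k%:R / n.+1%:R, k.+1%:R / n.+1%:R[] `&` [set` `[0, 1[] = set0 :> set R.
  by rewrite set0X.
rewrite -subset0 => r [] /=; rewrite !in_itv/= => /andP[kr _] /andP[_ r1].
have := le_lt_trans kr r1.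
by rewrite ltr_pdivrMr// mul1r ltr_nat ltnNge kn.
Unshelve. all: by end_near. Qed.

Section complex_continuity.
Context {R : realType}.
Local Open Scope complex_scope.
Implicit Types (z w : R[i]) (x y : R).

Lemma le_normc_dist z w : `|Normc.normc z - Normc.normc w| <= Normc.normc (z - w).
Proof.
have H u v : Normc.normc u - Normc.normc v <= Normc.normc (u - v).
  by rewrite lerBlDr -{1}(subrK v u) le_normcD.
have N : Normc.normc (z - w) = Normc.normc (w - z).
  by rewrite -[z - w]opprB; exact: normcN.
by rewrite ler_norml H andbT lerNl opprB N H.
Qed.

Lemma normc_le_Re_Im x y : Normc.normc (x +i* y) <= `|x| + `|y|.
Proof.
rewrite /Normc.normc -(@ler_pXn2r _ 2)// ?nnegrE ?sqrtr_ge0 ?addr_ge0//.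
rewrite sqr_sqrtr ?addr_ge0 ?sqr_ge0// sqrrD !real_normK ?num_real//.
by rewrite lerD2r lerDl mulrn_wge0// mulr_ge0.
Qed.

(** The norm of [R[i]^o] takes its values in [R[i]], where 0 < e means that e is real and positive;
    this translates limits to the real-valued modulus. *)
Lemma near_normcP T (F : set_system T) (FF : Filter F) (g : T -> R[i]^o) (l : R[i]^o) :
  (forall e, 0 < e -> \forall t \near F, Normc.normc (l - g t) < e) <->
  g t @[t --> F] --> l.
Proof.
split=> [h|/cvgrPdist_lt h e e0].
  apply/cvgrPdist_lt => e; rewrite ltcE => /andP[/eqP Ime Ree].
  by apply: filterS (h _ Ree) => t; rewrite normc_def ltcE /= Ime eqxx; case: (l - g t).
have e0' : 0 < e%:C by rewrite ltcE /= eqxx.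
by apply: filterS (h _ e0') => t; rewrite normc_def ltcE /= eqxx /=; case: (l - g t).
Qed.

Lemma cvg_complex T (F : set_system T) (FF : Filter F) (f g : T -> R) x y :
  f t @[t --> F] --> x -> g t @[t --> F] --> y ->
  (f t +i* g t : R[i]^o) @[t --> F] --> (x +i* y : R[i]^o).
Proof.
move=> /cvgrPdist_lt fx /cvgrPdist_lt gy; apply/near_normcP => e e0.
have e20 : 0 < e / 2 by rewrite divr_gt0.
apply: filterS2 (fx _ e20) (gy _ e20) => t ft gt.
apply: (le_lt_trans (normc_le_Re_Im (x - f t) (y - g t))).
by rewrite (splitr e) ltrD.
Qed.

Lemma cvg_normc T (F : set_system T) (FF : Filter F) (g : T -> R[i]^o) (l : R[i]^o) :
  g t @[t --> F] --> l -> Normc.normc (g t) @[t --> F] --> Normc.normc l.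
Proof.
move=> /near_normcP h; apply/cvgrPdist_lt => e e0; apply: filterS (h _ e0) => t.
exact: le_lt_trans (le_normc_dist _ _).
Qed.

Lemma holomorphic_disc_continuous (f : R[i] -> R[i]) z : holomorphic_disc f ->
  unit_disc z -> {for z, continuous (f : R[i]^o -> R[i]^o)}.
Proof. by move=> hf /hf /derivable1_diffP /differentiable_continuous. Qed.

Lemma normc_polar (r t : R) : Normc.normc (polar r t) = `|r|.
Proof.
rewrite /polar /Normc.normc !exprMn -mulrDr cos2Dsin2 mulr1.
exact: sqrtr_sqr.
Qed.

Lemma measurable_holomorphic_polar (f : R[i] -> R[i]) : holomorphic_disc f ->
  measurable_fun (([set` `[0, 1[] : set R) `*` setT)
    (fun z : R * R => Normc.normc (f (polar z.1 z.2))).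
Proof.
move=> hf.
have disc (r t : R) : 0 <= r < 1 -> unit_disc (polar r t).
  move=> /andP[r0 r1]; suff : Normc.normc (polar r t) < 1 by [].
  by rewrite normc_polar ger0_norm.
apply: measurable_fun_caratheodory => // [r r01|r t r01 _] /=.
  apply: (continuous_measurable_fun) => t.
  apply: cvg_normc; apply: (@cvg_comp _ _ _ (fun t => polar r t : R[i]^o)
    (f : R[i]^o -> R[i]^o) _ (nbhs (polar r t : R[i]^o))); last first.
    exact: holomorphic_disc_continuous (disc r t r01).
  by apply: cvg_complex; apply: cvgMr; [exact: continuous_cos|exact: continuous_sin].
apply: cvg_normc; apply: (@cvg_comp _ _ _ (fun r => polar r t : R[i]^o)
  (f : R[i]^o -> R[i]^o) _ (nbhs (polar r t : R[i]^o))); last first.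
  exact: holomorphic_disc_continuous (disc r t r01).
by apply: cvg_complex; apply: cvgMl; exact: cvg_id.
Qed.

End complex_continuity.

(** * Monotonicity of integrals and reflection of Lebesgue measure *)

Section integral_monotonicity.
Context d (T : measurableType d) (R : realType).
Variable mu : {measure set T -> \bar R}.
Local Open Scope ereal_scope.

(** The integral of a nonnegative function is a supremum over the simple functions below it, and
    this supremum is monotone for arbitrary functions. Inner integrals can thus be compared without
    proving them measurable in the outer variable. *)
Lemma ge0_le_integral_subset (A B : set T) (f g : T -> \bar R) :
  A `<=` B -> (forall x, A x -> 0 <= f x) -> (forall x, B x -> 0 <= g x) ->
  (forall x, A x -> f x <= g x) ->
  \int[mu]_(x in A) f x <= \int[mu]_(x in B) g x.
Proof.
move=> AB f0 g0 fg; rewrite !(integral_mkcond _ f) !(integral_mkcond _ g).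
rewrite !ge0_integralTE; [|exact: erestrict_ge0..].
apply: ge_ereal_sup => _ [h hf <-]; apply: ereal_sup_ubound; exists h => //= x.
apply: (le_trans (hf x)); rewrite !patchE.
case: ifPn => [/set_mem Ax|_]; first by rewrite mem_set ?fg//; exact: AB.
by case: ifPn => // /set_mem; exact: g0.
Qed.

Lemma ge0_le_integralW (D : set T) (f g : T -> \bar R) :
  (forall x, D x -> 0 <= f x) -> (forall x, D x -> f x <= g x) ->
  \int[mu]_(x in D) f x <= \int[mu]_(x in D) g x.
Proof.
move=> f0 fg; apply: ge0_le_integral_subset => // x Dx.
exact: le_trans (f0 _ Dx) (fg _ Dx).
Qed.

End integral_monotonicity.

Section lebesgue_reflection.
Context {R : realType}.
Local Notation mu := lebesgue_measure.
Implicit Types (c a b : R) (f : R -> \bar R).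

Lemma lebesgue_measure_reflection c (A : set R) : measurable A ->
  pushforward mu ((fun x => c - x) : R -> measurableTypeR R) A = mu A.
Proof.
move=> mA; have mc : measurable_fun setT ((fun x => c - x) : R -> measurableTypeR R).
  exact: measurable_funB.
apply/esym/lebesgue_measure_unique => //= _ [[a b]] _ <-.
rewrite /pushforward.
have -> : (fun x => c - x) @^-1` `]a, b]%classic = `[c - b, c - a[%classic.
  by apply/seteqP; split=> x /=; rewrite !in_itv/=; lra.
rewrite !lebesgue_measure_itv/= !lte_fin.
have -> : (c - b < c - a) = (a < b) by rewrite ltrD2l ltrN2.
by case: ifP => // _; rewrite -!EFinB; congr (_%:E); ring.
Qed.

Lemma ge0_integral_reflection c (D : set R) f : measurable D ->
  measurable_fun setT f -> (forall x, 0 <= f x)%E ->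
  (\int[mu]_(x in (fun x => (c - x)%R) @^-1` D) f (c - x)%R = \int[mu]_(x in D) f x)%E.
Proof.
move=> mD mf f0; have mc : measurable_fun setT ((fun x => c - x) : R -> measurableTypeR R).
  exact: measurable_funB.
transitivity (\int[pushforward mu ((fun x => (c - x)%R) : R -> measurableTypeR R)]_(y in D) f y)%E.
  by rewrite ge0_integral_pushforward//; exact: measurable_funS mf.
by apply: eq_measure_integral => //= A mA _; exact: lebesgue_measure_reflection.
Qed.

End lebesgue_reflection.

Lemma scale_regE (R : pzRingType) (u v : R) : u *: (v : R^o) = u * v.
Proof. by []. Qed.

(** * The logarithmic kernel: algebra, derivative, monotonicity *)

Section log_kernel.
Context {R : realType}.
Local Notation mu := lebesgue_measure.
Implicit Types (a b c x y : R).

(* [powlog a b c x] is [x ^ -a * (c - ln x) ^ -b]. *)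
Definition powlog a b c x : R := expR (- (a * ln x) - b * ln (c - ln x)).

Lemma powlog_ge0 a b c x : 0 <= powlog a b c x. Proof. exact: expR_ge0. Qed.

Lemma powlogM a b a' b' c x : powlog a b c x * powlog a' b' c x = powlog (a + a') (b + b') c x.
Proof. by rewrite /powlog -expRD; congr expR; ring. Qed.

Lemma powlog_powR a b c x m : powlog a b c x `^ m = powlog (a * m) (b * m) c x.
Proof. by rewrite /powlog -expRM; congr expR; ring. Qed.

Lemma powlog_scale a b c x k : 0 < k -> 0 < x ->
  powlog a b c (k * x) = expR (- (a * ln k)) * powlog a b (c - ln k) x.
Proof.
by move=> k0 x0; rewrite /powlog lnM ?posrE// -expRD opprD addrA; congr expR; ring.
Qed.

Lemma powlog_id c x : 0 < x -> powlog (-1) 0 c x = x.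
Proof. by move=> x0; rewrite /powlog mulN1r opprK mul0r subr0 lnK. Qed.

Lemma measurable_powlog a b c : measurable_fun setT (powlog a b c).
Proof.
apply: (measurableT_comp (@measurable_expR R)); apply: measurable_funB.
  by apply: measurable_funN; apply: measurable_funM => //; exact: measurable_ln.
apply: measurable_funM => //.
apply: (measurableT_comp (@measurable_ln R)); apply: measurable_funB => //.
Qed.

Lemma is_derive_powlog a b c x : 0 < x -> ln x < c ->
  is_derive x 1 (powlog a b c) (powlog a b c x * (b / (x * (c - ln x)) - a / x)).
Proof.
move=> x0 xc; have l0 : 0 < c - ln x by rewrite subr_gt0.
have d1 := is_derive1_ln x0.
have d2 : is_derive x 1 (fun x => c - ln x) (- x^-1).
  by apply: is_derive_eq; rewrite add0r mul1r.
have d3 := @is_derive1_comp _ (@ln R) (fun x => c - ln x) x _ _ (is_derive1_ln l0) d2.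
have d4 : is_derive x 1 (fun x => - (a * ln x) - b * ln (c - ln x))
   (b / (x * (c - ln x)) - a / x).
  pose d3' : is_derive x 1 (fun x => ln (c - ln x)) _ := d3.
  by apply: is_derive_eq; rewrite !scale_regE; field; rewrite !gt_eqF.
exact: (@is_derive1_comp _ expR (fun x => - (a * ln x) - b * ln (c - ln x))
  x _ _ (is_derive_expR _) d4).
Qed.

Lemma powlog_continuous a b c x : 0 < x -> ln x < c -> {for x, continuous (powlog a b c)}.
Proof.
move=> x0 xc; apply/differentiable_continuous/derivable1_diffP.
exact: (@ex_derive _ _ _ _ _ _ _ (is_derive_powlog a b x0 xc)).
Qed.

(** The logarithmic derivative b / (x (c - ln x)) - a / x is nonpositive exactly when b <= a (c - ln
    x). The right side decreases in x for a >= 0, so the condition at the right end y is enough. *)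
Lemma powlog_nonincreasing a b c x y : 0 <= b -> 0 < x -> x <= y -> ln y < c ->
  b <= a * (c - ln y) -> powlog a b c y <= powlog a b c x.
Proof.
move=> b0 x0 xy yc bac; have y0 := lt_le_trans x0 xy.
have lxy : ln x <= ln y by rewrite ler_ln ?posrE.
have ly0 : 0 < c - ln y by rewrite subr_gt0.
have lx0 : 0 < c - ln x by rewrite subr_gt0 (le_lt_trans lxy).
rewrite /powlog ler_expR.
(* concavity: ln l(x) - ln l(y) <= (l(x) - l(y)) / l(y) *)
have H : ln (c - ln x) - ln (c - ln y) <= (ln y - ln x) / (c - ln y).
  rewrite -ln_div ?posrE//.
  have -> : (c - ln x) / (c - ln y) = 1 + (ln y - ln x) / (c - ln y).
    by field; rewrite gt_eqF.
  apply: le_ln1Dx; rewrite (@lt_le_trans _ _ 0)//.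
  by rewrite divr_ge0 ?subr_ge0// ltW.
have H2 : b * (ln (c - ln x) - ln (c - ln y)) <= a * (ln y - ln x).
  apply: (le_trans (ler_wpM2l b0 H)).
  rewrite mulrCA mulrC ler_wpM2r ?subr_ge0//.
  by rewrite ler_pdivrMr.
by move: H2; lra.
Qed.

Lemma integral_derive (f F : R -> R) a b : a < b ->
  (forall x, a <= x <= b -> is_derive x 1 F (f x)) ->
  (forall x, a <= x <= b -> {for x, continuous f}) ->
  (\int[mu]_(x in `[a, b]) (f x)%:E = (F b - F a)%:E)%E.
Proof.
move=> ab dF cf.
have cF x : a <= x <= b -> {for x, continuous F}.
  move=> /dF dFx; apply/differentiable_continuous/derivable1_diffP.
  exact: (@ex_derive _ _ _ _ _ _ _ dFx).
rewrite (@continuous_FTC2 _ f F)//.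
- apply: continuous_in_subspaceT => x; rewrite inE/= in_itv/=; exact: cf.
- split.
  + move=> x; rewrite in_itv/= => /andP[/ltW ax /ltW xb].
    by apply: (@ex_derive _ _ _ _ _ _ _ (dF x _)); rewrite ax.
  + by apply: cvg_at_right_filter; apply: cF; rewrite lexx ltW.
  + by apply: cvg_at_left_filter; apply: cF; rewrite lexx ltW.
- move=> x; rewrite in_itv/= => /andP[/ltW ax /ltW xb].
  by rewrite derive1E; apply: derive_val; apply: dF; rewrite ax.
Qed.

End log_kernel.

(** * One-variable integrals of the kernel near 0 *)

Section kernel_integrals.
Context {R : realType}.
Local Notation mu := lebesgue_measure.
Implicit Types (a b c x y X Y : R).

(** [- powlog eta 0 c (x + y) / eta] is a primitive in y; its value at [Y] is nonpositive and is
    dropped, so the bound does not depend on [Y]. *)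
Lemma integral_powlog_shift (eta c x Y : R) : 0 < eta -> 0 < x -> 0 < Y ->
  ln (x + Y) < c ->
  (\int[mu]_(y in `]0%R, Y]) (powlog (1 + eta) 0 c (x + y))%:E <=
   (powlog eta 0 c x / eta)%:E)%E.
Proof.
move=> eta0 x0 Y0 xYc.
have xy0 y : 0 <= y -> 0 < x + y by move=> y0; rewrite ltr_wpDr.
have xyc y : 0 <= y <= Y -> ln (x + y) < c.
  move=> /andP[y0 yY]; apply: le_lt_trans xYc.
  by rewrite ler_ln ?posrE ?xy0 ?(ltW Y0)// lerD2l.
have dsh y : is_derive y 1 (fun y => x + y) 1.
  by apply: is_derive_eq; rewrite add0r mulr1.
apply: (@le_trans _ _ (\int[mu]_(y in `[0%R, Y]) (powlog (1 + eta) 0 c (x + y))%:E)%E).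
  apply: ge0_le_integral_subset => //.
  - by apply: subset_itvr; rewrite bnd_simp.
  - by move=> y _; rewrite lee_fin powlog_ge0.
  - by move=> y _; rewrite lee_fin powlog_ge0.
have dF y : 0 <= y <= Y -> is_derive y 1 (fun y => - (powlog eta 0 c (x + y)) / eta)
    (powlog (1 + eta) 0 c (x + y)).
  move=> /[dup] /xyc xyc' /andP[y0 _].
  pose dK' : is_derive y 1 (fun y => powlog eta 0 c (x + y)) _ :=
    @is_derive1_comp _ (powlog eta 0 c) (fun y => x + y) y _ _
      (is_derive_powlog eta 0 (xy0 _ y0) xyc') (dsh y).
  apply: is_derive_eq; rewrite !scale_regE ?scaler0 ?mulr0 add0r.
  have -> : powlog (1 + eta) 0 c (x + y) = powlog 1 0 c (x + y) * powlog eta 0 c (x + y).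
    by rewrite powlogM addr0.
  have -> : powlog 1 0 c (x + y) = (x + y)^-1.
    by rewrite /powlog mul0r subr0 mul1r expRN lnK// posrE xy0.
  by field; rewrite !gt_eqF ?xy0// subr_gt0.
have cf y : 0 <= y <= Y -> {for y, continuous (fun y => powlog (1 + eta) 0 c (x + y))}.
  move=> /[dup] /xyc xyc' /andP[y0 _].
  apply: (@continuous_comp _ _ _ (fun y => x + y) (powlog (1 + eta) 0 c)).
    by apply: cvgD; [exact: cvg_cst|exact: cvg_id].
  exact: powlog_continuous (xy0 _ y0) xyc'.
rewrite (integral_derive Y0 dF cf) lee_fin addr0 !mulNr opprK addrC gerBl.
by rewrite divr_ge0 ?powlog_ge0// ltW.
Qed.

Lemma integral_itv_inv_log (beta c e X : R) : 1 < beta -> 0 < e -> e < X -> ln X < c ->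
  (\int[mu]_(x in `[e, X]) (powlog 1 beta c x)%:E =
   ((powlog 0 (beta - 1) c X - powlog 0 (beta - 1) c e) / (beta - 1))%:E)%E.
Proof.
move=> b1 e0 eX Xc; have X0 : 0 < X by exact: lt_trans eX.
have xc x : e <= x <= X -> 0 < x /\ ln x < c.
  move=> /andP[ex xX]; have x0 := lt_le_trans e0 ex; split=> //.
  by apply: le_lt_trans Xc; rewrite ler_ln ?posrE.
have bn0 : beta - 1 != 0 by rewrite gt_eqF// subr_gt0.
rewrite mulrBl.
have dF x : e <= x <= X ->
    is_derive x 1 (fun x => powlog 0 (beta - 1) c x / (beta - 1)) (powlog 1 beta c x).
  move=> /xc[x0 xc']; have l0 : c - ln x != 0 by rewrite gt_eqF// subr_gt0.
  pose dK' : is_derive x 1 (powlog 0 (beta - 1) c) _ := is_derive_powlog 0 (beta - 1) x0 xc'.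
  apply: is_derive_eq; rewrite !scale_regE ?scaler0 ?mulr0 add0r.
  have -> : powlog 1 beta c x = powlog 1 1 c x * powlog 0 (beta - 1) c x.
    by rewrite powlogM addr0 addrC subrK.
  have -> : powlog 1 1 c x = (x * (c - ln x))^-1.
    by rewrite /powlog !mul1r -opprD expRN expRD !lnK// posrE ?subr_gt0.
  by field; rewrite l0 bn0 gt_eqF.
have cf x : e <= x <= X -> {for x, continuous (powlog 1 beta c)}.
  by move=> /xc[x0 xc']; exact: powlog_continuous.
exact: integral_derive eX dF cf.
Qed.

Lemma itvoc_bigcup_scale X : 0 < X ->
  \bigcup_n `[X / n.+1%:R, X]%classic = `]0, X]%classic.
Proof.
move=> X0; apply/seteqP; split=> [x [n _]|x] /=; rewrite !in_itv/=.
  by move=> /andP[Xx ->]; rewrite andbT (lt_le_trans _ Xx)// divr_gt0.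
move=> /andP[x0 xX]; exists (Num.trunc (X / x)) => //=; rewrite in_itv/= xX andbT.
rewrite ler_pdivrMr// mulrC -ler_pdivrMr//.
by apply/ltW; case/andP: (trunc_itv (divr_ge0 (ltW X0) (ltW x0))).
Qed.

(** The fundamental theorem needs a closed interval away from 0, so ]0, X] is exhausted by the
    intervals [X / (n + 1), X]. The primitive is nonnegative at the left end, which gives a bound
    uniform in n. *)
Lemma integral_inv_log_le (beta c X : R) : 1 < beta -> 0 < X -> ln X < c ->
  (\int[mu]_(x in `]0%R, X]) (powlog 1 beta c x)%:E <=
   (powlog 0 (beta - 1) c X / (beta - 1))%:E)%E.
Proof.
move=> b1 X0 Xc; rewrite -itvoc_bigcup_scale//.
have mK D : measurable_fun D (fun x => (powlog 1 beta c x)%:E).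
  by apply: measurable_funTS; apply/measurable_EFinP; exact: measurable_powlog.
pose F (n : nat) : set R := `[X / n.+1%:R, X]%classic.
rewrite -[\bigcup_n _]/(\bigcup_n F n).
have ndF : {homo F : n m / (n <= m)%N >-> (n <= m)%O}.
  move=> n k nk; rewrite subsetEset; apply: subset_itvr; rewrite bnd_simp.
  by rewrite ler_pM2l// lef_pV2 ?posrE// ler_nat.
have mF n : measurable (F n) by exact: measurable_itv.
have K0 n x : F n x -> (0 <= (powlog 1 beta c x)%:E)%E by rewrite lee_fin powlog_ge0.
have cv := @ge0_nondecreasing_set_cvg_integral _ _ _ _ _ mu ndF mF (fun n => mK (F n)) K0.
rewrite -(cvg_lim _ cv)//.
apply: lime_le; first by apply/cvg_ex; eexists; exact: cv.
apply: nearW => n; rewrite /F; have [eX|Xe] := ltP (X / n.+1%:R) X.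
  rewrite integral_itv_inv_log ?divr_gt0// lee_fin ler_pM2r ?invr_gt0 ?subr_gt0//.
  by rewrite gerBl powlog_ge0.
(* This is n = 0, where the interval reduces to the point [X]. *)
have e : X / n.+1%:R = X.
  apply/eqP; rewrite eq_le Xe andbT ler_pdivrMr// ler_peMr ?(ltW X0)//.
  by rewrite ler1n.
by rewrite e set_itv1 integral_set1 lee_fin divr_ge0 ?powlog_ge0// subr_ge0 ltW.
Qed.

Lemma integral_inv_log1 (c X : R) : 0 < X -> ln X < c ->
  (\int[mu]_(x in `]0%R, X]) (powlog 1 1 c x)%:E = +oo)%E.
Proof.
move=> X0 Xc; apply/eqyP => A A0.
have l0 : 0 < c - ln X by rewrite subr_gt0.
(* Solves c - ln e = exp(A) (c - ln X), so that the primitive -ln(c - ln x) increases by exactly [A]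
   from [e] to [X]. *)
pose e := expR (c - expR A * (c - ln X)).
have le : c - ln e = expR A * (c - ln X) by rewrite /e expRK; ring.
have eX : e < X.
  rewrite -ltr_ln ?posrE ?expR_gt0// -(ltrN2) -(ltrD2l c) le.
  by rewrite ltr_pMl// -expR0 ltr_expR.
apply: (@le_trans _ _ (\int[mu]_(x in `[e, X]) (powlog 1 1 c x)%:E)%E); last first.
  apply: ge0_le_integral_subset => //.
  - move=> x /=; rewrite !in_itv/= => /andP[ex ->]; rewrite andbT.
    exact: lt_le_trans (expR_gt0 _) ex.
  - by move=> y _; rewrite lee_fin powlog_ge0.
  - by move=> y _; rewrite lee_fin powlog_ge0.
have xc x : e <= x <= X -> 0 < x /\ ln x < c.
  move=> /andP[ex xX]; have x0 := lt_le_trans (expR_gt0 _) ex; split=> //.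
  by apply: le_lt_trans Xc; rewrite ler_ln ?posrE.
have dF x : e <= x <= X -> is_derive x 1 (fun x => - ln (c - ln x)) (powlog 1 1 c x).
  move=> /xc[x0 xc']; have lx0 : 0 < c - ln x by rewrite subr_gt0.
  have d1 := is_derive1_ln x0.
  have d2 : is_derive x 1 (fun x => c - ln x) (- x^-1).
    by apply: is_derive_eq; rewrite add0r mul1r.
  pose d3 : is_derive x 1 (fun x => ln (c - ln x)) _ :=
    @is_derive1_comp _ (@ln R) (fun x => c - ln x) x _ _ (is_derive1_ln lx0) d2.
  apply: is_derive_eq.
  rewrite /powlog !mul1r -opprD expRN expRD !lnK// ?posrE//.
  by field; rewrite !gt_eqF.
have cf x : e <= x <= X -> {for x, continuous (powlog 1 1 c)}.
  by move=> /xc[x0 xc']; exact: powlog_continuous.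
rewrite (integral_derive eX dF cf) le lnM ?posrE ?expR_gt0// expRK lee_fin; lra.
Qed.

End kernel_integrals.

(** * Mixed integrals of the kernel, finite and infinite *)

Lemma le_poweR (R : realType) (r : R) (x y : \bar R) :
  0 <= r -> (0 <= x)%E -> (x <= y)%E -> (x `^ r <= y `^ r)%E.
Proof.
move=> r0 x0 xy; apply: gt0_ler_poweR => //; rewrite in_itv/= leey andbT//.
exact: le_trans xy.
Qed.

Section mixed_integrals_of_the_kernel.
Context {R : realType}.
Local Notation mu := lebesgue_measure.
Implicit Types (D : set R) (d : R -> R).

(* [d] measures the distance to the singularity, and takes each value at most
   twice, with Jacobian 1. *)
Definition folds D d (X : R) := (forall x, D x -> 0 <= d x <= X) /\
  (forall phi : R -> \bar R, measurable_fun setT phi -> (forall x, 0 <= phi x)%E ->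
    \int[mu]_(x in D) phi (d x) <= 2%:E * \int[mu]_(x in `]0%R, X]) phi x)%E.

Lemma folds_radial (X : R) : 1 <= X -> folds `[0, 1[ (fun r => 1 - r) X.
Proof.
move=> X1; split=> [x /=|phi mphi phi0]; first by rewrite in_itv/=; lra.
have -> : `[0, 1[%classic = (fun r => 1 - r) @^-1` `]0, 1]%classic :> set R.
  by apply/seteqP; split=> x /=; rewrite !in_itv/=; lra.
rewrite ge0_integral_reflection//.
apply: (@le_trans _ _ (\int[mu]_(x in `]0%R, X]) phi x)%E).
  by apply: ge0_le_integral_subset => //; apply: subset_itvl; rewrite bnd_simp.
apply: lee_pemull; first exact: integral_ge0.
by rewrite lee_fin ler1n.
Qed.

(** The map is the identity on ]0, pi] and a reflection on ]pi, 2 pi[; each half contributes at most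
    one integral over ]0, 4], since pi < 4. The two endpoints form a null set. *)
Lemma folds_angular :
  folds `[0, 2 * pi] (fun t : R => Num.min t (2 * pi - t)) (4 : R).
Proof.
have pi0 := pi_gt0 R; have pi4 : pi < 4 :> R by have := @pihalf_lt2 R; lra.
split=> [x /=|phi mphi phi0].
  rewrite in_itv/= => /andP[x0 x2]; rewrite le_min ge_min; apply/andP; split.
    by apply/andP; split; lra.
  by apply/orP; have [xp|px] := leP x pi; [left|right]; lra.
have mg : measurable_fun setT (fun t : R => phi (Num.min t (2 * pi - t))).
  apply: (measurableT_comp mphi); apply: measurable_minr => //.
  exact: measurable_funB.
rewrite integral_itv_bndoo; last exact: measurable_funS mg.
have -> : `]0, 2 * pi[%classic = `]0, pi]%classic `|` `]pi, 2 * pi[%classic :> set R.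
  by apply/seteqP; split=> x /=; rewrite !in_itv/=; [case: (leP x pi); lra|lra].
rewrite ge0_integral_setU//; last 2 first.
- exact: measurable_funS mg.
- by apply/disj_setPS => x /=; rewrite !in_itv/=; lra.
rewrite -[X in (_ <= X)%E]/((1 + 1)%:E * _)%E EFinD ge0_muleDl// !mul1e.
apply: leeD.
  apply: ge0_le_integral_subset => //.
  - by apply: subset_itvl; rewrite bnd_simp ltW.
  - by move=> x /=; rewrite in_itv/= => /andP[x0 xpi]; rewrite min_l//; lra.
apply: (@le_trans _ _ (\int[mu]_(t in `]pi, (2 * pi)%R[) phi (2 * pi - t)%R)%E).
  apply: ge0_le_integralW => // x /=; rewrite in_itv/= => /andP[x0 xpi].
  by rewrite min_r//; lra.
have -> : `]pi, 2 * pi[%classic = (fun t => 2 * pi - t) @^-1` `]0, pi[%classic :> set R.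
  by apply/seteqP; split=> x /=; rewrite !in_itv/=; lra.
rewrite ge0_integral_reflection//; apply: ge0_le_integral_subset => //.
by apply: subset_itvl; rewrite bnd_simp ltW.
Qed.

Lemma mixed_integral_finite D D' d d' (h : R -> R -> R) (X m M b c C : R) :
  0 < m -> 0 < M -> 0 <= b -> 1 < b * M -> 0 < X -> 0 <= C ->
  ln (X + X) < c -> 2 * M * b <= c - ln (X + X) ->
  folds D d X -> folds D' d' X ->
  (forall x y, D x -> D' y -> 0 < d x ->
    0 <= h x y <= C * powlog (m^-1 + M^-1) b c (d x + d' y)) ->
  (\int[mu]_(x in D)
    (\int[mu]_(y in D') (h x y `^ m)%:E) `^ (M / m) < +oo)%E.
Proof.
move=> m0 M0 b0 bM X0 C0 Xc bc [dX foldD] [dX' foldD'] hK.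
have [mn0 Mn0] : m != 0 /\ M != 0 by rewrite !gt_eqF.
(* Half of the excess of (1/m + 1/M) m over 1. In the m-th power of the kernel, s^-(1 + eta)
   integrates to at most x^-eta / eta, while s^-eta (c - ln s)^(-b m) is bounded by its value at x:
   it is nonincreasing as soon as b m <= eta (c - ln s), that is 2 M b <= c - ln s. The product
   carries x^(-2 eta), whose power M / m is x^-1. *)
pose eta := m / (2 * M).
have eta0 : 0 < eta by rewrite divr_gt0// mulr_gt0.
pose C2 := 2 * (C `^ m / eta).
have C20 : 0 <= C2 by rewrite mulr_ge0// divr_ge0 ?powR_ge0// ltW.
(* The value +oo at 0 makes the bound trivial at points where [d] vanishes; it costs nothing,
   because [folds] integrates over ]0, X] only. *)
pose psi x : \bar R := if 0 < x then (C2 `^ (M / m) * powlog 1 (b * M) c x)%:E else +oo%E.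
have Mm0 : 0 <= M / m by rewrite divr_ge0// ltW.
have inner x : D x -> 0 < d x ->
    (\int[mu]_(y in D') (h x y `^ m)%:E <= (C2 * powlog (eta + eta) (b * m) c (d x))%:E)%E.
  move=> Dx dx0; have /andP[_ dxX] := dX x Dx.
  pose B := C `^ m * powlog eta (b * m) c (d x).
  have B0 : 0 <= B by rewrite mulr_ge0 ?powR_ge0 ?powlog_ge0.
  pose phi y : \bar R := (B%:E * (powlog (1 + eta) 0 c (d x + y))%:E)%E.
  have mK : measurable_fun setT (fun y => (powlog (1 + eta) 0 c (d x + y))%:E).
    apply/measurable_EFinP; apply: (measurableT_comp (measurable_powlog _ _ _)).
    exact: measurable_funD.
  apply: (@le_trans _ _ (\int[mu]_(y in D') phi (d' y))%E).
    apply: ge0_le_integralW => [y _|y D'y]; first by rewrite lee_fin powR_ge0.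
    have /andP[d'y0 d'yX] := dX' y D'y.
    have /andP[h0 hle] := hK x y Dx D'y dx0.
    have s0 : 0 < d x + d' y by rewrite ltr_wpDr.
    have sX : d x + d' y <= X + X by exact: lerD.
    have ls : ln (d x + d' y) <= ln (X + X) by rewrite ler_ln ?posrE// addr_gt0.
    rewrite /phi -EFinM lee_fin.
    apply: (@le_trans _ _ ((C * powlog (m^-1 + M^-1) b c (d x + d' y)) `^ m)).
      by rewrite ge0_ler_powR ?(ltW m0)// nnegrE// mulr_ge0// powlog_ge0.
    rewrite powRM ?powlog_ge0// powlog_powR /B -!mulrA ler_wpM2l ?powR_ge0//.
    have -> : (m^-1 + M^-1) * m = eta + (1 + eta) by rewrite /eta; field; rewrite ?mn0 ?Mn0.
    rewrite -[b * m in X in X <= _]addr0 -powlogM ler_wpM2r ?powlog_ge0//.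
    apply: powlog_nonincreasing => //.
    - by rewrite mulr_ge0// ltW.
    - by rewrite lerDl.
    - exact: le_lt_trans Xc.
    - rewrite (mulrC b) /eta -mulrA ler_pM2l// ler_pdivlMl ?mulr_gt0//.
      by apply: (le_trans bc); rewrite lerD2l lerN2.
  apply: (le_trans (foldD' phi _ _)).
  - exact: measurable_funeM.
  - by move=> y; rewrite mule_ge0// lee_fin// powlog_ge0.
  rewrite /C2 -mulrA EFinM lee_wpmul2l// /phi.
  rewrite ge0_integralZl//; last 2 first.
  - exact: measurable_funS mK.
  - by move=> y _; rewrite lee_fin powlog_ge0.
  apply: (@le_trans _ _ (B%:E * (powlog eta 0 c (d x) / eta)%:E)%E).
    rewrite lee_wpmul2l// integral_powlog_shift//.
    by apply: le_lt_trans Xc; rewrite ler_ln ?posrE ?addr_gt0// lerD2r.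
  by rewrite -EFinM lee_fin /B -[b * m in X in _ <= X]addr0 -powlogM; lra.
have outer x : D x -> ((\int[mu]_(y in D') (h x y `^ m)%:E) `^ (M / m) <= psi (d x))%E.
  move=> Dx; rewrite /psi; case: ifPn => [dx0|_]; last exact: leey.
  have i0 : (0 <= \int[mu]_(y in D') (h x y `^ m)%:E)%E.
    by apply: integral_ge0 => y _; rewrite lee_fin powR_ge0.
  apply: (le_trans (le_poweR Mm0 i0 (inner x Dx dx0))).
  rewrite poweR_EFin powRM ?powlog_ge0// powlog_powR lee_fin.
  have -> : (eta + eta) * (M / m) = 1 by rewrite /eta; field; rewrite ?mn0 ?Mn0.
  by have -> : b * m * (M / m) = b * M by field.
have mpsi : measurable_fun setT psi.
  apply: measurable_fun_if => //.
  - exact: measurable_fun_ltr.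
  - apply: measurable_funTS; apply/measurable_EFinP; apply: measurable_funM => //.
    exact: measurable_powlog.
have psi0 x : (0 <= psi x)%E.
  by rewrite /psi; case: ifP => _; rewrite ?leey// lee_fin mulr_ge0 ?powR_ge0 ?powlog_ge0.
apply: (@le_lt_trans _ _ (\int[mu]_(x in D) psi (d x))%E).
  by apply: ge0_le_integralW => // x _; exact: poweR_ge0.
apply: (le_lt_trans (foldD _ mpsi psi0)).
apply: (@le_lt_trans _ _ (2%:E * \int[mu]_(x in `]0%R, X])
    ((C2 `^ (M / m))%:E * (powlog 1 (b * M) c x)%:E))%E).
  rewrite lee_wpmul2l//; apply: ge0_le_integralW => // x /=; rewrite in_itv/=.
  by rewrite /psi => /andP[-> _]; rewrite EFinM.
rewrite ge0_integralZl//; last 3 first.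
- by apply: measurable_funTS; apply/measurable_EFinP; exact: measurable_powlog.
- by move=> x _; rewrite lee_fin powlog_ge0.
- by rewrite lee_fin powR_ge0.
apply: lte_mul_pinfty => //; apply: lte_mul_pinfty; rewrite ?lee_fin ?powR_ge0//.
have lX : ln X < c by apply: le_lt_trans Xc; rewrite ler_ln ?posrE ?addr_gt0// lerDl ltW.
by apply: (le_lt_trans (integral_inv_log_le bM X0 lX)); rewrite ltry.
Qed.

(** In use, [E x] consists of points y whose distance to the singularity is at most [d x]. The two
    distances then add up to at most 2 d x, where the kernel is bounded below, and the measure of
    [E x] turns this into a lower bound for the inner integral. *)
Lemma mixed_integral_infinite D D0 D' d (E : R -> set R) (h : R -> R -> R) (m M b c : R) :
  0 < m -> 0 < M -> b * M = 1 -> ln 2 < c ->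
  D0 `<=` D -> (forall x, D0 x -> 0 < d x <= 1) ->
  (forall psi : R -> \bar R, measurable_fun setT psi -> (forall x, 0 <= psi x)%E ->
    \int[mu]_(x in `]0%R, 1%R]) psi x <= \int[mu]_(x in D0) psi (d x))%E ->
  (forall x, D0 x -> [/\ measurable (E x), E x `<=` D' & ((d x)%:E <= mu (E x))%E]) ->
  (forall x y, D0 x -> E x y -> powlog (m^-1 + M^-1) b c (2 * d x) <= h x y) ->
  (\int[mu]_(x in D)
    (\int[mu]_(y in D') (h x y `^ m)%:E) `^ (M / m) = +oo)%E.
Proof.
move=> m0 M0 bM c2 D0D d01 foldD0 EP hK; set a := m^-1 + M^-1.
have [mn0 Mn0] : m != 0 /\ M != 0 by rewrite !gt_eqF.
have Mm0 : 0 <= M / m by rewrite divr_ge0// ltW.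
(* The factor 2^-a extracted from the argument 2 d x, raised to the powers m and M / m; the same
   rescaling replaces c by c - ln 2. *)
pose e := (expR (- (a * ln 2)) `^ m) `^ (M / m).
have e0 : 0 < e by rewrite !powR_gt0// expR_gt0.
pose psi x : \bar R := (e%:E * (powlog 1 1 (c - ln 2) x)%:E)%E.
apply/eqP; rewrite eq_le leey /=.
have mK : measurable_fun setT (fun x => (powlog 1 1 (c - ln 2) x)%:E).
  by apply/measurable_EFinP; exact: measurable_powlog.
apply: (@le_trans _ _ (\int[mu]_(x in D0) psi (d x))%E); last first.
  apply: ge0_le_integral_subset => // [x _|x _|x D0x].
  - by rewrite mule_ge0// lee_fin ?powlog_ge0// ltW.
  - exact: poweR_ge0.
  have [mE ED' dE] := EP x D0x; have /andP[dx0 dx1] := d01 x D0x.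
  apply: (@le_trans _ _ (((powlog a b c (2 * d x) `^ m)%:E * (d x)%:E) `^ (M / m))%E).
    rewrite -EFinM poweR_EFin /psi -EFinM lee_fin powlog_scale//.
    (* The length [d x] is itself written as a [powlog], so that exponents add up: (a m - 1) M / m =
       1 and b M = 1. *)
    rewrite powRM ?expR_ge0 ?powlog_ge0// powlog_powR -{3}[d x](powlog_id (c - ln 2))//.
    rewrite -mulrA powlogM powRM ?powR_ge0 ?powlog_ge0// powlog_powR addr0.
    have -> : (a * m + -1) * (M / m) = 1 by rewrite /a; field; rewrite ?mn0 ?Mn0.
    by have -> : b * m * (M / m) = 1 by rewrite -bM; field.
  apply: le_poweR => //; first by rewrite mule_ge0// lee_fin ?powR_ge0// ltW.
  apply: (@le_trans _ _ (\int[mu]_(y in E x) (powlog a b c (2 * d x) `^ m)%:E)%E).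
    by rewrite integral_cst// lee_wpmul2l// lee_fin powR_ge0.
  apply: ge0_le_integral_subset => // y Exy; rewrite lee_fin ?powR_ge0//.
  rewrite ge0_ler_powR ?nnegrE ?powlog_ge0 ?(ltW m0) ?hK//.
  by rewrite (le_trans _ (hK x y D0x Exy))// powlog_ge0.
apply: le_trans (foldD0 psi _ _); last 2 first.
- exact: measurable_funeM.
- by move=> x; rewrite mule_ge0// lee_fin ?powlog_ge0// ltW.
rewrite ge0_integralZl//; last 3 first.
- exact: measurable_funS mK.
- by move=> x _; rewrite lee_fin powlog_ge0.
- by rewrite lee_fin ltW.
rewrite integral_inv_log1// ?ln1 ?subr_gt0//.
by rewrite gt0_muley.
Qed.

End mixed_integrals_of_the_kernel.

(** * Elementary bounds for sin, cos and exp *)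

Section trigonometric_bounds.
Context {R : realType}.
Implicit Types (x y B : R).

Lemma mean_value_bound (f df : R -> R) B y :
  (forall x : R, is_derive x 1 f (df x)) -> (forall x, `|x| <= `|y| -> `|df x| <= B) ->
  `|f y - f 0| <= B * `|y|.
Proof.
move=> fd dfB.
have cf : continuous f.
  move=> x; apply/differentiable_continuous/derivable1_diffP.
  exact: (@ex_derive _ _ _ _ _ _ _ (fd x)).
have mvt a b : a <= b -> exists2 c, c \in `[a, b] & f b - f a = df c * (b - a).
  by move=> ab; apply: MVT_segment => //; exact: continuous_subspaceT.
have [y0|/ltW y0] := leP 0 y.
  have [z + ->] := mvt 0 y y0.
  rewrite in_itv/= => /andP[z0 zy]; rewrite subr0 normrM ler_wpM2r// dfB//.
  by rewrite !ger0_norm.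
have [z + e] := mvt y 0 y0.
rewrite in_itv/= => /andP[yz z0]; rewrite distrC e sub0r normrM normrN ler_wpM2r// dfB//.
by rewrite !ler0_norm// lerN2.
Qed.

Lemma norm_sin_le x : `|sin x| <= `|x|.
Proof.
have -> : sin x = sin x - sin 0 by rewrite sin0 subr0.
rewrite -[X in _ <= X]mul1r.
by apply: (@mean_value_bound sin cos) => // y _; rewrite ler_norml cos_geN1 cos_le1.
Qed.

Lemma norm_cosB1_le x : `|cos x - 1| <= x ^+ 2.
Proof.
rewrite -(@cos0 R) -real_normK ?num_real// expr2.
apply: (@mean_value_bound cos (fun x => - sin x)) => // y yx.
by rewrite normrN (le_trans (norm_sin_le y)).
Qed.

Lemma cosB1_half x : 1 - cos x = 2 * sin (x / 2) ^+ 2.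
Proof.
have -> : cos x = cos ((x / 2) *+ 2) by congr cos; rewrite mulr2n -splitr.
by rewrite cos_mulr2n cos2sin2; ring.
Qed.

Lemma cosB1_ge x : 1 - cos x <= x ^+ 2 / 2.
Proof.
rewrite cosB1_half.
have : sin (x / 2) ^+ 2 <= (x / 2) ^+ 2.
  rewrite -[sin _ ^+ 2]real_normK ?num_real// -[(x / 2) ^+ 2]real_normK ?num_real//.
  by rewrite ler_pXn2r ?nnegrE// norm_sin_le.
by lra.
Qed.

Lemma norm_sinB_le x : `|x| <= 1 -> `|sin x - x| <= x ^+ 2.
Proof.
move=> x1; have -> : sin x - x = (sin x - x) - (sin 0 - 0) by rewrite sin0; ring.
rewrite -real_normK ?num_real// expr2.
apply: (@mean_value_bound (fun x => sin x - x) (fun x => cos x - 1)) => y yx.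
apply: (le_trans (norm_cosB1_le y)); rewrite -real_normK ?num_real// expr2.
by rewrite (le_trans (ler_piMr _ (le_trans yx x1)))// normr_ge0.
Qed.

Lemma norm_expRB_le x : `|x| <= 1 / 2 -> `|expR x - 1 - x| <= 2 * x ^+ 2.
Proof.
rewrite ler_norml => /andP[xl xu].
have h1 := expR_ge1Dx x.
have h2 : expR x <= (1 - x)^-1.
  rewrite -[x in expR x]opprK expRN lef_pV2 ?posrE ?expR_gt0//; first exact: expR_ge1Dx.
  by lra.
have h3 : (1 - x)^-1 - 1 - x <= 2 * x ^+ 2.
  have -> : (1 - x)^-1 - 1 - x = x ^+ 2 / (1 - x) by field; lra.
  by rewrite ler_pdivrMr; [have := sqr_ge0 x; nra|lra].
by rewrite ger0_norm; lra.
Qed.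

(** On [0, 1] the derivative of sin y - y has modulus at most 1/2, so sin y >= y / 2. Beyond 1, sin
    x exceeds sin 1 >= 1/2, and x <= pi / 2 < 2 gives x / 4 < 1/2. *)
Lemma sin_ge_quarter x : 0 <= x <= pi / 2 -> x / 4 <= sin x.
Proof.
move=> /andP[x0 xpi]; have pi2 := @pihalf_lt2 R; have pi1 := @pihalf_ge1 R.
have small y : 0 <= y <= 1 -> y / 2 <= sin y.
  move=> /andP[y0 y1].
  have h : `|(sin y - y) - (sin 0 - 0)| <= 1 / 2 * `|y|.
    apply: (@mean_value_bound (fun x => sin x - x) (fun x => cos x - 1)) => z zy.
    have := cosB1_ge z; have := cos_le1 z.
    have : z ^+ 2 <= 1.
      rewrite -real_normK ?num_real// -(expr1n _ 2) ler_pXn2r ?nnegrE//.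
      by rewrite (le_trans zy)// ger0_norm.
    by move=> z1 c1 c2; rewrite ler0_norm; lra.
  by move: h; rewrite sin0 !subr0 (ger0_norm y0) ler_norml; lra.
have [x1|x1] := leP x 1; first by have := small x; rewrite x0 x1 => /(_ isT); lra.
have s1 : 1 / 2 <= sin 1 :> R by apply: small; rewrite ler01 lexx.
have : sin 1 < sin x.
  by rewrite ltr_sin// in_itv/=; apply/andP; split; lra.
by lra.
Qed.

Lemma cosB1_le x : 0 <= x <= pi -> x ^+ 2 / 32 <= 1 - cos x.
Proof.
move=> /andP[x0 xpi]; rewrite cosB1_half.
have h : x / 2 / 4 <= sin (x / 2) by apply: sin_ge_quarter; lra.
have : (x / 2 / 4) ^+ 2 <= sin (x / 2) ^+ 2.
  by rewrite ler_pXn2r ?nnegrE//; lra.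
by lra.
Qed.

End trigonometric_bounds.

(** * Complex exponential and principal logarithm *)

Section complex_exponential_logarithm.
Context {R : realType}.
Local Open Scope complex_scope.
Local Notation C := (R[i]^o).
Implicit Types (z w h : R[i]) (x y : R).

Definition cexp z : R[i] :=
  (expR (complex.Re z) * cos (complex.Im z)) +i* (expR (complex.Re z) * sin (complex.Im z)).

(* The principal branch, on the half plane [0 < complex.Re w]. *)
Definition clog w : R[i] := ln (Normc.normc w) +i* atan (complex.Im w / complex.Re w).

Lemma normc_cexp z : Normc.normc (cexp z) = expR (complex.Re z).
Proof.
rewrite /cexp /Normc.normc !exprMn -mulrDr cos2Dsin2 mulr1.
by rewrite sqrtr_sqr ger0_norm// expR_ge0.
Qed.

Lemma cexpD z w : cexp (z + w) = cexp z * cexp w.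
Proof.
case: z w => [a b] [c d]; rewrite /cexp /=; simpc.
by rewrite expRD cosD sinD; congr (_ +i* _); ring.
Qed.

Lemma cexp0 : cexp 0 = 1.
Proof. by rewrite /cexp /= expR0 cos0 sin0 !mul1r. Qed.

Lemma norm_Re_le z : `|complex.Re z| <= Normc.normc z.
Proof.
case: z => a b /=; rewrite -sqrtr_sqr ler_sqrt ?addr_ge0 ?sqr_ge0//.
by rewrite lerDl sqr_ge0.
Qed.

Lemma norm_Im_le z : `|complex.Im z| <= Normc.normc z.
Proof.
case: z => a b /=; rewrite -sqrtr_sqr ler_sqrt ?addr_ge0 ?sqr_ge0//.
by rewrite lerDr sqr_ge0.
Qed.

Lemma normc_ge0 z : 0 <= Normc.normc z.
Proof. by case: z => a b; rewrite /Normc.normc sqrtr_ge0. Qed.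

(** Quadratic remainder bounds for exp, cos and sin are combined in each coordinate; 8 collects 2 +
    2 from the real part and 3 + 1 from the imaginary part. *)
Lemma normc_cexpB_le h : Normc.normc h <= 1 / 2 ->
  Normc.normc (cexp h - 1 - h) <= 8 * Normc.normc h ^+ 2.
Proof.
have := norm_Re_le h; have := norm_Im_le h.
case: h => x y; set r := Normc.normc (x +i* y) => yr xr r2; rewrite /= in yr xr.
rewrite [X in Normc.normc X](_ : _ =
    (expR x * cos y - 1 - x) +i* (expR x * sin y - y)); last first.
  by apply/eqP; rewrite eq_complex /= subr0 !eqxx.
apply: (le_trans (normc_le_Re_Im _ _)).
have hx : `|x| <= 1 / 2 by exact: le_trans r2.
have hy : `|y| <= 1 by apply: (le_trans yr); lra.
have e1 := norm_expRB_le hx.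
have e2 := norm_cosB1_le y.
have e3 := norm_sinB_le hy.
have e4 := norm_sin_le y.
have e5 : `|cos y| <= 1 by rewrite ler_norml cos_geN1 cos_le1.
have xx : x ^+ 2 <= r ^+ 2.
  by rewrite -real_normK ?num_real// ler_pXn2r ?nnegrE// normc_ge0.
have yy : y ^+ 2 <= r ^+ 2.
  by rewrite -real_normK ?num_real// ler_pXn2r ?nnegrE// normc_ge0.
have e6 : `|expR x * cos y - 1 - x| <= 2 * r ^+ 2 + 2 * r ^+ 2.
  have -> : expR x * cos y - 1 - x = (expR x - 1 - x) * cos y + (1 + x) * (cos y - 1).
    by ring.
  apply: (le_trans (ler_normD _ _)); apply: lerD; rewrite normrM.
    by rewrite (le_trans (ler_pM _ _ e1 e5))// mulr1 ler_pM2l.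
  have hx' : `|1 + x| <= 2.
    by apply: (le_trans (ler_normD _ _)); rewrite normr1; lra.
  exact: (ler_pM _ _ hx' (le_trans e2 yy)).
have e7 : `|expR x * sin y - y| <= 3 * r ^+ 2 + r ^+ 2.
  have -> : expR x * sin y - y = (expR x - 1) * sin y + (sin y - y) by ring.
  apply: (le_trans (ler_normD _ _)); apply: lerD; last exact: le_trans e3 yy.
  have hx' : `|expR x - 1| <= 3 * r.
    have -> : expR x - 1 = (expR x - 1 - x) + x by ring.
    apply: (le_trans (ler_normD _ _)).
    have : r ^+ 2 <= 1 / 2 * r by rewrite expr2 ler_wpM2r// normc_ge0.
    by have := normr_ge0 x; lra.
  by rewrite normrM (le_trans (ler_pM _ _ hx' (le_trans e4 yr)))// -mulrA -expr2.
by lra.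
Qed.

Lemma near_neq0 : \forall h \near (0 : C)^', h != 0 :> R[i].
Proof. exact: (@nbhs_dnbhs_neq C 0). Qed.

Lemma cvg_cexp_quotient : (fun h => (cexp h - 1) / h : C) h @[h --> (0 : C)^'] --> (1 : C).
Proof.
apply/near_normcP => e e0.
pose del := Num.min (1 / 2) (e / 16).
have del0 : 0 < del by rewrite lt_min !divr_gt0.
have del0' : 0 < del%:C by rewrite ltcE /= eqxx.
have near_del := @dnbhs0_lt _ C _ del0'.
near=> h.
have h0 : h != 0 by near: h; exact: near_neq0.
have : `|h| < del%:C by near: h; exact: near_del.
rewrite normc_def ltcE /= => /andP[_]; rewrite -/(Normc.normc (complex.Re h +i* complex.Im h)).
have -> : complex.Re h +i* complex.Im h = h by case: (h).
rewrite lt_min => /andP[/ltW hh he].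
have nh : 0 < Normc.normc h.
  rewrite lt_neqAle normc_ge0 andbT eq_sym; apply: contra h0 => /eqP.
  by move=> /Normc.eq0_normc ->.
have -> : 1 - (cexp h - 1) / h = - (cexp h - 1 - h) / h.
  by field.
rewrite Normc.normcM Normc.normcV ltr_pdivrMr//.
have -> : Normc.normc (- (cexp h - 1 - h)) = Normc.normc (cexp h - 1 - h).
  exact: normcN.
apply: (le_lt_trans (normc_cexpB_le hh)).
by rewrite expr2 mulrA ltr_pM2r//; lra.
Unshelve. all: by end_near. Qed.

(** The functional equation reduces the difference quotient at z to the one at 0. *)
Lemma derivable_cexp z : derivable (cexp : C -> C) z 1.
Proof.
apply/cvg_ex; exists (cexp z : C).
rewrite [X in X @ _ --> _](_ : _ = fun h : C => (cexp z : C) * ((cexp h - 1) / h)).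
  rewrite -[X in _ --> X]mulr1.
  by apply: cvgM; [exact: cvg_cst|exact: cvg_cexp_quotient].
apply/funext => h /=; rewrite /shift /= [h *: 1]mulr1 cexpD.
by rewrite [LHS]mulrC [in LHS](mulrC (cexp h)) -{2}[cexp z]mulr1 -mulrBr mulrA.
Qed.

Lemma clogK w : 0 < complex.Re w -> cexp (clog w) = w.
Proof.
case: w => x y /= x0; rewrite /cexp /clog /=.
have n0 : 0 < Num.sqrt (x ^+ 2 + y ^+ 2).
  by rewrite sqrtr_gt0 ltr_wpDr ?sqr_ge0// exprn_gt0.
have ne : Num.sqrt (x ^+ 2 + y ^+ 2) = x * Num.sqrt (1 + (y / x) ^+ 2).
  have -> : x ^+ 2 + y ^+ 2 = x ^+ 2 * (1 + (y / x) ^+ 2) by field; rewrite gt_eqF.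
  by rewrite sqrtrM ?sqr_ge0// sqrtr_sqr gtr0_norm.
have q0 : 0 < Num.sqrt (1 + (y / x) ^+ 2).
  by rewrite sqrtr_gt0 ltr_wpDr ?sqr_ge0.
have c0 : cos (atan (y / x)) != 0 by rewrite cos_atan invr_eq0 gt_eqF.
have -> : sin (atan (y / x)) = y / x * cos (atan (y / x)).
  by apply: (canRL (divfK c0)); exact: atanK.
rewrite lnK ?posrE// cos_atan ne.
by congr (_ +i* _); field; rewrite !gt_eqF.
Qed.

Lemma cvg_Re z : (@complex.Re R : C -> R) w @[w --> (z : C)] --> complex.Re z.
Proof.
apply/(@cvgrPdist_lt _ _ _ (nbhs (z : C)) _) => e e0.
have /near_normcP := @cvg_id C (nbhs (z : C)) => /(_ e e0).
apply: filterS => w; apply: le_lt_trans.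
by have := norm_Re_le (z - w); case: z w => [a b] [c d].
Qed.

Lemma cvg_Im z : (@complex.Im R : C -> R) w @[w --> (z : C)] --> complex.Im z.
Proof.
apply/(@cvgrPdist_lt _ _ _ (nbhs (z : C)) _) => e e0.
have /near_normcP := @cvg_id C (nbhs (z : C)) => /(_ e e0).
apply: filterS => w; apply: le_lt_trans.
by have := norm_Im_le (z - w); case: z w => [a b] [c d].
Qed.

Lemma normc_gt0_Re w : 0 < complex.Re w -> 0 < Normc.normc w.
Proof. by move=> w0; apply: lt_le_trans (norm_Re_le w); rewrite gtr0_norm. Qed.

Lemma continuous_clog w : 0 < complex.Re w -> {for w, continuous (clog : C -> C)}.
Proof.
move=> w0.
have cn : ln (Normc.normc u) @[u --> (w : C)] --> ln (Normc.normc w).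
  apply: (@cvg_comp _ _ _ (@Normc.normc R : C -> R) (@ln R)); last first.
    by apply: continuous_ln; exact: normc_gt0_Re.
  exact: (@cvg_normc R C (nbhs (w : C)) _ id w (@cvg_id _ _)).
have ca : atan (complex.Im u / complex.Re u) @[u --> (w : C)] -->
    atan (complex.Im w / complex.Re w).
  apply: (@cvg_comp _ _ _ (fun u : C => complex.Im u / complex.Re u) (@atan R)); last first.
    exact: continuous_atan.
  have wn0 : complex.Re w != 0 by rewrite gt_eqF.
  exact: (cvgM (@cvg_Im w) (cvgV wn0 (@cvg_Re w))).
exact: (cvg_complex _ cn ca).
Qed.

(* [clog] is a continuous local inverse of [cexp], so the increments [k] of
   [clog] tend to [0] and [k / h = (w (cexp k - 1) / k) ^-1]. *)
Lemma derivable_clog w : 0 < complex.Re w -> derivable (clog : C -> C) w 1.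
Proof.
move=> w0.
have wn0 : w != 0 by apply: contraTneq w0 => ->; rewrite /= ltxx.
pose k (h : C) : C := clog (h + w) - clog w.
have cvg_shift : (h + w : C) @[h --> (0 : C)^'] --> (w : C).
  rewrite -[X in _ --> X]add0r; apply: cvgD; last exact: cvg_cst.
  exact: cvg_within.
have cvg_k : k h @[h --> (0 : C)^'] --> (0 : C).
  have c1 := @cvg_comp _ _ _ (fun h : C => h + w : C) (clog : C -> C) _ _ _
    cvg_shift (continuous_clog w0).
  apply/near_normcP => e e0; move/near_normcP : c1 => /(_ _ e0).
  apply: filterS => h; have -> : (0 : C) - k h = clog w - clog (h + w).
    by rewrite /k sub0r opprB.
  exact.
have near_Re : \forall h \near (0 : C)^', 0 < complex.Re (h + w).
  have := @cvg_comp _ _ _ _ _ _ _ _ cvg_shift (@cvg_Re w).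
  move=> /cvgrPdist_lt /(_ _ w0); apply: filterS => h /=.
  by rewrite ltr_norml; lra.
have hE h : 0 < complex.Re (h + w) -> h = w * (cexp (k h) - 1).
  move=> hw; have : cexp (k h + clog w) = h + w by rewrite /k subrK clogK.
  by rewrite cexpD clogK// => e; rewrite mulrBr mulr1 mulrC e addrK.
(* The quotient limit is taken along punctured neighbourhoods, so k(h) has to avoid 0: by [hE], k(h)
   = 0 would force h = 0. *)
have cvg_k' : k h @[h --> (0 : C)^'] --> (0 : C)^'.
  move=> A A0; have kA : \forall h \near (0 : C)^', k h != 0 :> R[i] -> A (k h).
    exact: cvg_k A0.
  change (\forall h \near (0 : C)^', A (k h)); near=> h.
  have h0 : h != 0 :> R[i] by near: h; exact: near_neq0.
  have hw : 0 < complex.Re (h + w) by near: h.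
  have : k h != 0 :> R[i] -> A (k h) by near: h.
  apply; apply/eqP => kh; have := hE h hw.
  by rewrite kh cexp0 subrr mulr0 => /eqP; apply/negP.
have cvg_q := cvgM (cvg_cst (w : C))
  (@cvg_comp _ _ _ k (fun h : C => (cexp h - 1) / h : C) _ _ _ cvg_k' cvg_cexp_quotient).
have w1 : (w : C) * 1 != 0 by rewrite mulr1.
have cv : ((w * ((cexp (k h) - 1) / k h))^-1 : C) @[h --> (0 : C)^'] --> (((w : C) * 1)^-1 : C).
  exact: (cvgV w1 (cvg_q _ _)).
apply/cvg_ex; exists (((w : C) * 1)^-1 : C).
move/near_normcP : cv => cv; apply/near_normcP => e e0.
have cve := cv e e0; near=> h.
have hw : 0 < complex.Re (h + w) by near: h.
rewrite [X in _ - X](_ : _ = (w * ((cexp (k h) - 1) / k h))^-1); first by near: h.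
rewrite /= /shift /= [h *: 1]mulr1 -/(k h) mulrA -(hE h hw) invf_div.
exact: mulrC.
Unshelve. all: by end_near. Qed.

End complex_exponential_logarithm.

(** * The extremal function and its size *)

Section extremal_function.
Context {R : realType}.
Local Open Scope complex_scope.
Local Notation C := (R[i]^o).
Implicit Types (z w : R[i]) (a b c r t : R).

(* [(1 - z) ^ -a * (c - log (1 - z)) ^ -b] *)
Definition log_power a b c z : R[i] :=
  cexp (- (a%:C * clog (1 - z)) - b%:C * clog (c%:C - clog (1 - z))).

Lemma Re_1B_gt0 z : unit_disc z -> 0 < complex.Re (1 - z).
Proof.
rewrite /unit_disc /= => z1.
have -> : complex.Re (1 - z) = 1 - complex.Re z by case: (z).
by rewrite subr_gt0 (le_lt_trans _ z1)// (le_trans (ler_norm _)) ?norm_Re_le.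
Qed.

Lemma normc_1B_lt2 z : unit_disc z -> Normc.normc (1 - z) < 2.
Proof.
rewrite /unit_disc /= => z1; have := le_normcD (1 : R[i]) (- z).
have -> : Normc.normc (- z) = Normc.normc z by exact: normcN.
rewrite Normc.normc1 => /le_lt_trans; apply.
by rewrite -[2]/(1 + 1) ltrD2l.
Qed.

Lemma ln_normc_1B_le z : unit_disc z -> ln (Normc.normc (1 - z)) <= ln 2.
Proof.
move=> hz; rewrite ler_ln ?posrE ?(ltW (normc_1B_lt2 hz))//.
exact: normc_gt0_Re (Re_1B_gt0 hz).
Qed.

Lemma Re_B_clog c w : complex.Re (c%:C - clog w) = c - ln (Normc.normc w).
Proof. by rewrite /clog; simpc. Qed.

Lemma Im_B_clog c w : complex.Im (c%:C - clog w) = - atan (complex.Im w / complex.Re w).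
Proof. by rewrite /clog; simpc. Qed.

(** Since |1 - z| < 2, the condition ln 2 < c keeps c - log(1 - z) in the right half plane, where
    the outer logarithm is differentiable. *)
Lemma holomorphic_log_power a b c : ln 2 < c -> holomorphic_disc (log_power a b c).
Proof.
move=> c2 z hz; have w0 := Re_1B_gt0 hz.
have v0 : 0 < complex.Re (c%:C - clog (1 - z)).
  by rewrite Re_B_clog subr_gt0 (le_lt_trans (ln_normc_1B_le hz)).
have d1 : differentiable (fun z : C => 1 - z : C) (z : C).
  by apply: differentiableB; [exact: differentiable_cst|exact/derivable1_diffP/derivable_id].
have d2 := differentiable_comp d1 (iffLR (derivable1_diffP _ _) (derivable_clog w0)).
have d3 : differentiable (fun z : C => c%:C - clog (1 - z) : C) (z : C).
  by apply: differentiableB; [exact: differentiable_cst|exact: d2].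
have d4 := differentiable_comp d3 (iffLR (derivable1_diffP _ _) (derivable_clog v0)).
have d5 : differentiable (fun z : C => - (a%:C *: (clog (1 - z) : C)) -
    b%:C *: (clog (c%:C - clog (1 - z)) : C) : C) (z : C).
  apply: differentiableB; last by apply: differentiableZ; exact: d4.
  by apply: differentiableN; apply: differentiableZ; exact: d2.
apply/derivable1_diffP.
have dexp u : differentiable (cexp : C -> C) u.
  by apply/derivable1_diffP; exact: derivable_cexp.
exact: (differentiable_comp d5 (dexp _)).
Qed.

Lemma normc_log_power a b c z : Normc.normc (log_power a b c z) =
  expR (- (a * ln (Normc.normc (1 - z))) -
        b * ln (Normc.normc (c%:C - clog (1 - z)))).
Proof. by rewrite normc_cexp /clog; simpc. Qed.

(** The modulus of c - log(1 - z) is at least its real part c - ln |1 - z|. *)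
Lemma normc_log_power_le a b c z : 0 <= b -> ln 2 < c -> unit_disc z ->
  Normc.normc (log_power a b c z) <= powlog a b c (Normc.normc (1 - z)).
Proof.
move=> b0 c2 hz; rewrite normc_log_power /powlog ler_expR lerD2l lerN2 ler_wpM2l//.
have l0 : 0 < c - ln (Normc.normc (1 - z)).
  by rewrite subr_gt0 (le_lt_trans (ln_normc_1B_le hz)).
have le : c - ln (Normc.normc (1 - z)) <= Normc.normc (c%:C - clog (1 - z)).
  by rewrite -Re_B_clog (le_trans (ler_norm _)) ?norm_Re_le.
by rewrite ler_ln ?posrE// (lt_le_trans l0).
Qed.

(** The imaginary part of c - log(1 - z) is smaller than pi / 2 < 2 in modulus, so the full modulus
    exceeds the real part by at most 2: hence the shift to c + 2. *)
Lemma normc_log_power_ge a b c z : 0 <= b -> ln 2 < c -> unit_disc z ->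
  powlog a b (c + 2) (Normc.normc (1 - z)) <= Normc.normc (log_power a b c z).
Proof.
move=> b0 c2 hz; rewrite normc_log_power /powlog ler_expR lerD2l lerN2 ler_wpM2l//.
have l0 : 0 < c - ln (Normc.normc (1 - z)).
  by rewrite subr_gt0 (le_lt_trans (ln_normc_1B_le hz)).
have le : c - ln (Normc.normc (1 - z)) <= Normc.normc (c%:C - clog (1 - z)).
  by rewrite -Re_B_clog (le_trans (ler_norm _)) ?norm_Re_le.
have ge : Normc.normc (c%:C - clog (1 - z)) <= c + 2 - ln (Normc.normc (1 - z)).
  have E : forall v : R[i], Normc.normc v <= `|complex.Re v| + `|complex.Im v|.
    by move=> [x y]; exact: normc_le_Re_Im.
  apply: (le_trans (E _)); rewrite Re_B_clog Im_B_clog normrN gtr0_norm//.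
  suff : `|atan (complex.Im (1 - z) / complex.Re (1 - z))| <= 2 by lra.
  have := atan_gtNpi2 (complex.Im (1 - z) / complex.Re (1 - z)).
  have := atan_ltpi2 (complex.Im (1 - z) / complex.Re (1 - z)).
  by have := @pihalf_lt2 R; rewrite ler_norml; lra.
by rewrite ler_ln ?posrE// ?(lt_le_trans l0)//; lra.
Qed.

Lemma polar_unit_disc r t : 0 <= r < 1 -> unit_disc (polar r t).
Proof.
move=> /andP[r0 r1]; suff : Normc.normc (polar r t) < 1 by [].
by rewrite normc_polar ger0_norm.
Qed.

Lemma normc_1B_polar r t : Normc.normc (1 - polar r t) ^+ 2 =
  (1 - r) ^+ 2 + 2 * r * (1 - cos t).
Proof.
have -> : 1 - polar r t = (1 - r * cos t) +i* (- (r * sin t)).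
  by rewrite /polar; apply/eqP; rewrite eq_complex /= sub0r !eqxx.
rewrite /Normc.normc sqr_sqrtr ?addr_ge0 ?sqr_ge0//.
have := cos2Dsin2 t; set x := cos t; set y := sin t => e.
rewrite sqrrN exprMn.
have -> : y ^+ 2 = 1 - x ^+ 2 by lra.
by ring.
Qed.

Lemma normc_1B_polar_le r t : 0 <= r < 1 -> 0 <= t ->
  Normc.normc (1 - polar r t) <= (1 - r) + t.
Proof.
move=> /andP[r0 r1] t0.
rewrite -(@ler_pXn2r _ 2)// ?nnegrE ?normc_ge0//; last by lra.
rewrite normc_1B_polar.
have h := cosB1_ge t; have h0 : 0 <= 1 - cos t by rewrite subr_ge0 cos_le1.
have : r * (1 - cos t) <= 1 * (1 - cos t) by rewrite ler_wpM2r// ltW.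
have : 0 <= (1 - r) * t by rewrite mulr_ge0//; lra.
by nra.
Qed.

(** For r <= 1/2 the term 1 - r alone suffices, because tau <= pi < 4 <= 8 (1 - r) and 9 = 1 + 8.
    For r > 1/2 the squared modulus is at least (1 - r)^2 + tau^2 / 32, and (u + tau)^2 <= 2 u^2 + 2
    tau^2 with 2 / 81 <= 1 / 32. *)
Lemma normc_1B_polar_ge r t : 0 <= r < 1 -> 0 <= t <= 2 * pi ->
  9^-1 * ((1 - r) + Num.min t (2 * pi - t)) <= Normc.normc (1 - polar r t).
Proof.
move=> /andP[r0 r1] /andP[t0 t2]; have pi2 := @pihalf_lt2 R.
set tau := Num.min _ _.
have tau0 : 0 <= tau by rewrite /tau le_min t0 subr_ge0.
have taupi : tau <= pi.
  by rewrite /tau ge_min; apply/orP; have [h|h] := leP t pi; [left|right]; lra.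
have ctau : cos t = cos tau.
  rewrite /tau; have [//|_] := leP t (2 * pi - t).
  have -> : 2 * pi - t = - t + pi *+ 2 by ring.
  by rewrite cosD2pi cosN.
have h : tau ^+ 2 / 32 <= 1 - cos t by rewrite ctau cosB1_le// tau0.
have h0 : 0 <= 1 - cos t by rewrite subr_ge0 cos_le1.
rewrite -(@ler_pXn2r _ 2)// ?nnegrE ?normc_ge0//; last first.
  by rewrite mulr_ge0// addr_ge0//; lra.
rewrite normc_1B_polar; have [r2|r2] := leP r (1 / 2).
  apply: (@le_trans _ _ ((1 - r) ^+ 2)).
    rewrite ler_pXn2r ?nnegrE//; [lra| |lra].
    by rewrite mulr_ge0// addr_ge0//; lra.
  by rewrite lerDl mulr_ge0// mulr_ge0.
have : 1 * (1 - cos t) <= 2 * r * (1 - cos t) by rewrite ler_wpM2r//; lra.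
have : 0 <= ((1 - r) - tau) ^+ 2 by exact: sqr_ge0.
have : 0 <= (1 - r) ^+ 2 by exact: sqr_ge0.
have : 0 <= tau ^+ 2 by exact: sqr_ge0.
by nra.
Qed.

End extremal_function.

(** * Exchange of the order of integration in mixed norms *)

Section mixed_norm_inequality.
Context d1 d2 (T1 : measurableType d1) (T2 : measurableType d2) (R : realType).
Variables (m1 : {sigma_finite_measure set T1 -> \bar R})
          (m2 : {sigma_finite_measure set T2 -> \bar R}).
Local Open Scope ereal_scope.

(** Minkowski for the power alpha of [G] with s = beta / alpha. [G] extends [g] by 0 because
    Minkowski integrates over the whole spaces, while [g] is controlled on [D1] x [D2] only. *)
Lemma mixed_norm_le (D1 : set T1) (D2 : set T2) (g : T1 -> T2 -> R)
    (G : T1 * T2 -> R) (alpha beta : R) :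
  (0 < alpha < beta)%R -> measurable D1 -> m1 D1 < +oo ->
  measurable_fun setT G -> (forall z, 0 <= G z)%R ->
  (forall x y, D1 x -> D2 y -> G (x, y) = g x y) ->
  (forall z, ~ D1 z.1 -> G z = 0%R) -> (forall z, ~ D2 z.2 -> G z = 0%R) ->
  \int[m1]_(x in D1) (\int[m2]_(y in D2) (g x y `^ alpha)%:E) `^ (beta / alpha) <=
  (\int[m2]_(y in D2) (\int[m1]_(x in D1) (g x y `^ beta)%:E) `^ (alpha / beta))
    `^ (beta / alpha).
Proof.
move=> /andP[a0 ab] mD fD mG G0 Gg GD1 GD2.
have b0 : (0 < beta)%R by exact: lt_trans ab.
have [an0 bn0] : alpha != 0%R /\ beta != 0%R by rewrite !gt_eqF.
have s0 : (0 <= beta / alpha)%R by rewrite divr_ge0// ltW.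
have s1 : (1 < beta / alpha)%R by rewrite ltr_pdivlMr// mul1r.
have mGa : measurable_fun setT (fun z => G z `^ alpha)%R.
  exact: (measurableT_comp (measurable_powR _)).
have pow_ge0 x y r : 0 <= (g x y `^ r)%:E by rewrite lee_fin powR_ge0.
have sn0 : (beta / alpha != 0)%R by rewrite mulf_neq0 ?invr_eq0.
have GD1a z : ~ D1 z.1 -> (G z `^ alpha = 0)%R by move=> /GD1 ->; rewrite powR0.
have mink := minkowski_integral m2 s1 mD fD mGa (fun z => powR_ge0 _ _) GD1a.
apply: le_trans (le_trans mink _).
  apply: ge0_le_integral_subset; [by []|by move=> x _; exact: poweR_ge0..|].
  move=> x D1x; apply: (le_poweR s0); first by apply: integral_ge0.
  apply: ge0_le_integral_subset => // [y _|y D2y]; first by rewrite lee_fin powR_ge0.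
  by rewrite Gg.
apply: (le_poweR s0); first by apply: integral_ge0 => y _; exact: poweR_ge0.
rewrite [leRHS]integral_mkcond; apply: ge0_le_integralW => y _; first exact: poweR_ge0.
rewrite patchE; case: ifPn => [/set_mem D2y|/negP D2y].
  rewrite invf_div; apply: le_poweR; first by rewrite divr_ge0// ltW.
    by apply: integral_ge0 => x _; rewrite lee_fin powR_ge0.
  rewrite [leRHS]integral_mkcond; apply: ge0_le_integralW => x _.
    by rewrite lee_fin powR_ge0.
  rewrite patchE -powRrM mulrCA divff// mulr1; case: ifPn => [/set_mem D1x|/negP D1x].
    by rewrite Gg.
  by rewrite GD1/= ?powR0// => /mem_set.
rewrite integral0_eq ?poweR0r ?invr_eq0// => x _.
by rewrite GD2/= ?powR0// => /mem_set.
Qed.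

End mixed_norm_inequality.

(** * The two norms in polar coordinates and the inclusions *)

Section polar_mixed_norms.
Context {R : realType}.
Local Notation mu := lebesgue_measure.
Implicit Types (f : R[i] -> R[i]) (p q : R).

(** The inner exponent comes first, here and in [angular_outer]: [Hnorm q p] corresponds to
    [radial_outer f q p] and [rho p q] to [angular_outer f p q]. The factor 1 / (2 pi) and the outer
    root are left out, as only finiteness matters. *)
Definition radial_outer f (alpha beta : R) : \bar R :=
  (\int[mu]_(r in `[0%R, 1%R[)
    (\int[mu]_(t in `[0%R, (2 * pi)%R])
      (Normc.normc (f (polar r t)) `^ alpha)%:E) `^ (beta / alpha))%E.

Definition angular_outer f (alpha beta : R) : \bar R :=
  (\int[mu]_(t in `[0%R, (2 * pi)%R])
    (\int[mu]_(r in `[0%R, 1%R[)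
      (Normc.normc (f (polar r t)) `^ alpha)%:E) `^ (beta / alpha))%E.

Definition polar_ext f (z : R * R) : R :=
  if (z.1 \in `[0, 1[) && (z.2 \in `[0, 2 * pi]) then Normc.normc (f (polar z.1 z.2))
  else 0.

Lemma polar_ext_ge0 f z : 0 <= polar_ext f z.
Proof. by rewrite /polar_ext; case: ifP => // _; exact: normc_ge0. Qed.

Lemma polar_extE f (r t : R) : r \in `[0, 1[ -> t \in `[0, 2 * pi] ->
  polar_ext f (r, t) = Normc.normc (f (polar r t)).
Proof. by rewrite /polar_ext /= => -> ->. Qed.

Lemma measurable_polar_ext f : holomorphic_disc f -> measurable_fun setT (polar_ext f).
Proof.
move=> hf; pose D : set (R * R) := [set` `[0, 1[] `*` [set` `[0, 2 * pi]].
have mD : measurable D by apply: measurableX; exact: measurable_itv.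
have -> : polar_ext f = (fun z => Normc.normc (f (polar z.1 z.2))) \_ D.
  apply/funext => z; rewrite /polar_ext patchE.
  by rewrite (_ : (z \in D) = (z.1 \in `[0, 1[) && (z.2 \in `[0, 2 * pi]))// in_setX !mem_setE.
apply: (proj1 (measurable_restrictT _ mD)).
have mE : measurable ([set` `[0, 1[] `*` setT : set (R * R)).
  by apply: measurableX => //; exact: measurable_itv.
have DE : D `<=` [set` `[0, 1[] `*` setT by move=> z [].
refine (measurable_funS mE DE _); exact: (@measurable_holomorphic_polar R f hf).
Qed.

Lemma radial_outer_le f (alpha beta : R) : holomorphic_disc f -> 0 < alpha < beta ->
  (radial_outer f alpha beta <= (angular_outer f beta alpha) `^ (beta / alpha))%E.
Proof.
move=> hf ab.
apply: (@mixed_norm_le _ _ _ _ _ mu mu _ _ (fun r t => Normc.normc (f (polar r t)))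
  (polar_ext f)) => //.
- by rewrite /= lebesgue_measure_itv/= lte01 oppr0 adde0 ltry.
- exact: measurable_polar_ext.
- exact: polar_ext_ge0.
- by move=> r t; exact: polar_extE.
- by move=> z /negP z1; rewrite /polar_ext (negbTE z1).
- by move=> z /negP z2; rewrite /polar_ext (negbTE z2) andbF.
Qed.

Lemma angular_outer_le f (alpha beta : R) : holomorphic_disc f -> 0 < alpha < beta ->
  (angular_outer f alpha beta <= (radial_outer f beta alpha) `^ (beta / alpha))%E.
Proof.
move=> hf ab.
apply: (@mixed_norm_le _ _ _ _ _ mu mu _ _ (fun t r => Normc.normc (f (polar r t)))
  (fun z : R * R => polar_ext f (z.2, z.1))) => //.
- rewrite /= lebesgue_measure_itv/= lte_fin mulr_gt0 ?pi_gt0//.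
  by rewrite oppr0 adde0 ltry.
- apply: (measurableT_comp (measurable_polar_ext hf)); exact: measurable_fun_pair.
- by move=> z; exact: polar_ext_ge0.
- by move=> t r tI rI; exact: polar_extE.
- by move=> z /negP z1; rewrite /polar_ext /= (negbTE z1) andbF.
- by move=> z /negP z2; rewrite /polar_ext /= (negbTE z2).
Qed.

Lemma rho_ltyP p q f : 0 < p -> 0 < q ->
  (rho p q f < +oo)%E <-> (angular_outer f p q < +oo)%E.
Proof.
move=> p0 q0; have k0 : 0 < (2 * pi)^-1 :> R by rewrite invr_gt0 mulr_gt0// pi_gt0.
split=> [|fin].
  move=> /(lty_poweRy (invr_neq0 (lt0r_neq0 q0))); rewrite -/(angular_outer f p q).
  have : (0 <= angular_outer f p q)%E.
    by apply: integral_ge0 => t _; exact: poweR_ge0.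
  by case: (angular_outer f p q) => [x| |]//= _; rewrite ?ltry// gt0_muley ?lte_fin.
apply: poweR_lty; apply: lte_mul_pinfty => //.
by rewrite lee_fin ltW.
Qed.

(** Unlike in [rho], the factor 1 / (2 pi) sits in the inner integral. It comes out with the power p
    / q, and moving it past the outer integral uses measurability of the inner one, obtained from
    Tonelli for [polar_ext]. *)
Lemma Hnorm_ltyP p q f : 0 < p -> 0 < q -> holomorphic_disc f ->
  (Hnorm q p f < +oo)%E <-> (radial_outer f q p < +oo)%E.
Proof.
move=> p0 q0 hf; have k0 : 0 < (2 * pi)^-1 :> R by rewrite invr_gt0 mulr_gt0// pi_gt0.
have mG := measurable_polar_ext hf.
pose k := (2 * pi)^-1 `^ (p / q) : R.
have kp : 0 < k by rewrite powR_gt0.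
have mpow (alpha : R) : measurable_fun setT (fun z : R * R => (polar_ext f z `^ alpha)%:E).
  by apply/measurable_EFinP; exact: (measurableT_comp (measurable_powR _)).
pose mF r := (\int[mu]_t (polar_ext f (r, t) `^ q)%:E)%E.
have mmF : measurable_fun setT mF.
  have pow_ge0 z : (0 <= (polar_ext f z `^ q)%:E)%E by rewrite lee_fin powR_ge0.
  refine (@measurable_fun_fubini_tonelli_F _ _ _ _ R mu _ (mpow q) pow_ge0).
have inner r : r \in `[0, 1[ ->
    (\int[mu]_(t in `[0%R, (2 * pi)%R]) (Normc.normc (f (polar r t)) `^ q / (2 * pi))%:E =
     (2 * pi)^-1%:E *
     \int[mu]_(t in `[0%R, (2 * pi)%R]) (Normc.normc (f (polar r t)) `^ q)%:E)%E.
  move=> r01; under eq_integral do rewrite EFinM.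
  rewrite ge0_integralZr//.
  - by rewrite muleC.
  - apply: (eq_measurable_fun (fun t => (polar_ext f (r, t) `^ q)%:E)).
      by move=> t; rewrite inE => tI; rewrite polar_extE.
    by apply: measurable_funTS; apply: (measurableT_comp (mpow q)); exact: measurable_pair1.
  - by move=> t _; rewrite lee_fin powR_ge0.
  - by rewrite lee_fin ltW.
have HE : Hnorm q p f = ((k%:E * radial_outer f q p) `^ p^-1)%E.
  rewrite /Hnorm; congr (_ `^ _)%E.
  transitivity (\int[mu]_(r in `[0%R, 1%R[) (k%:E *
    (\int[mu]_(t in `[0%R, (2 * pi)%R])
      (Normc.normc (f (polar r t)) `^ q)%:E) `^ (p / q)))%E.
    apply: eq_integral => r; rewrite inE => /inner ->.
    rewrite poweRM ?poweR_EFin// ?lee_fin ?(ltW k0)//.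
    by apply: integral_ge0 => t _; rewrite lee_fin powR_ge0.
  rewrite ge0_integralZl//.
  - apply: (eq_measurable_fun (fun r => (mF r `^ (p / q))%E)).
      move=> r; rewrite inE => rI; congr (poweR _ (p / q)).
      rewrite /mF [RHS]integral_mkcond; apply: eq_integral => t _.
      rewrite patchE; case: ifPn => [|/negP tI]; first by rewrite inE => tI; rewrite polar_extE.
      rewrite /polar_ext /= rI /= ifF ?powR0 ?gt_eqF//.
      by apply/negP => tI'; apply: tI; rewrite inE.
    by apply: measurable_funTS; exact: (measurableT_comp (measurable_poweR _)).
  - by move=> r _; exact: poweR_ge0.
  - by rewrite lee_fin ltW.
have ge0 : (0 <= radial_outer f q p)%E.
  by apply: integral_ge0 => t _; exact: poweR_ge0.
rewrite HE; split=> [/(lty_poweRy (invr_neq0 (lt0r_neq0 p0)))|fin].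
  by case: (radial_outer f q p) ge0 => [x| |]//= _; rewrite ?ltry// gt0_muley ?lte_fin.
apply: poweR_lty; apply: lte_mul_pinfty => //.
by rewrite lee_fin ltW.
Qed.

End polar_mixed_norms.

(** * Mixed norms of the extremal function *)

Section log_power_norms.
Context {R : realType}.
Local Notation mu := lebesgue_measure.
Variables (p q b c : R).
Hypotheses (p0 : 0 < p) (q0 : 0 < q) (b0 : 0 <= b).
Let a := p^-1 + q^-1.
Let f := log_power a b c.
(** [hc] yields 2 M b <= c + ln 9 - ln (X + X) for X = 4 and either outer exponent M among p and q;
    [hbc] makes the kernel nonincreasing up to 2, which covers the range of |1 - z|. *)
Hypotheses (hc : ln 8 + 2 * (p + q) * b < c) (hbc : b <= a * (c - ln 2)).

Let a0 : 0 < a. Proof. by rewrite addr_gt0 ?invr_gt0. Qed.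

Let pqb0 : 0 <= 2 * (p + q) * b.
Proof. by rewrite mulr_ge0// mulr_ge0// ltW// addr_gt0. Qed.

Let ln28 : 0 < ln (2 : R) /\ ln (2 : R) <= ln 8.
Proof. by rewrite ln_gt0 ?ltr1n// ler_ln ?posrE// ler_nat. Qed.

Let c2 : ln 2 < c. Proof. by have [] := ln28; have := pqb0; have := hc; lra. Qed.

Let ln9 : 0 < ln 9 :> R. Proof. by rewrite ln_gt0// ltr1n. Qed.

Let bound_le (r t : R) : `[0, 1[%classic r -> `[0, 2 * pi]%classic t ->
  0 < (1 - r) + Num.min t (2 * pi - t) ->
  Normc.normc (f (polar r t)) <=
  expR (a * ln 9) * powlog a b (c + ln 9) ((1 - r) + Num.min t (2 * pi - t)).
Proof.
rewrite /= !in_itv/= => r01 t2; set s := _ + _ => s0.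
have hz := polar_unit_disc t r01.
have sz := normc_1B_polar_ge r01 t2; rewrite -/s in sz.
apply: (le_trans (normc_log_power_le _ b0 c2 hz)).
(* The factor 1/9 in the lower bound for |1 - z| turns into 9^a in front and c + ln 9 inside the
   logarithmic factor. *)
have -> : expR (a * ln 9) * powlog a b (c + ln 9) s = powlog a b c (9^-1 * s).
  by rewrite powlog_scale ?invr_gt0// lnV ?posrE// mulrN !opprK.
have lz := ln_normc_1B_le hz.
apply: powlog_nonincreasing => //.
- by rewrite mulr_gt0.
- exact: le_lt_trans lz c2.
- by apply: (le_trans hbc); rewrite ler_pM2l// lerD2l lerN2.
Qed.

Let bound_ge (r t x : R) : 0 <= r < 1 -> 0 <= t -> (1 - r) + t <= x -> x <= 2 ->
  powlog a b (c + 2) x <= Normc.normc (f (polar r t)).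
Proof.
move=> r01 t0 tx x2; have hz := polar_unit_disc t r01.
apply: le_trans (normc_log_power_ge _ b0 c2 hz).
have z0 := normc_gt0_Re (Re_1B_gt0 hz).
have zx := le_trans (normc_1B_polar_le r01 t0) tx.
have lx : ln x <= ln 2 by rewrite ler_ln ?posrE// (lt_le_trans z0).
apply: powlog_nonincreasing => //; first by have := c2; lra.
by apply: (le_trans hbc); rewrite ler_pM2l//; lra.
Qed.

Let ln44 : ln (4 + 4) = ln 8 :> R. Proof. by congr ln; rewrite -natrD. Qed.

Let le_pqb M : 0 < M -> M <= p + q -> 2 * M * b <= (c + ln 9) - ln (4 + 4).
Proof.
move=> M0 Mpq; have : 2 * M * b <= 2 * (p + q) * b by rewrite ler_wpM2r// ler_pM2l.
by rewrite ln44; have := hc; have := ln9; lra.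
Qed.

Lemma radial_outer_log_power_lty : 1 < b * p -> (radial_outer f q p < +oo)%E.
Proof.
move=> bp; have X0 : 0 < 4 :> R by [].
have C0 : 0 <= expR (a * ln 9) by exact: expR_ge0.
apply: (@mixed_integral_finite _ _ _ (fun r => 1 - r) (fun t => Num.min t (2 * pi - t))
  (fun r t => Normc.normc (f (polar r t))) 4 q p b (c + ln 9) _ q0 p0 b0 bp X0 C0) => //.
- by rewrite ln44; have := hc; have := ln9; have := pqb0; lra.
- by apply: le_pqb => //; rewrite lerDl ltW.
- by apply: folds_radial; rewrite ler1n.
- exact: folds_angular.
- move=> r t r01 t2 r1; rewrite normc_ge0 (addrC q^-1) bound_le//.
  by rewrite ltr_wpDr// (andP (folds_angular.1 _ t2)).1.
Qed.

Lemma angular_outer_log_power_lty : 1 < b * q -> (angular_outer f p q < +oo)%E.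
Proof.
move=> bq; have X0 : 0 < 4 :> R by [].
have C0 : 0 <= expR (a * ln 9) by exact: expR_ge0.
apply: (@mixed_integral_finite _ _ _ (fun t => Num.min t (2 * pi - t)) (fun r => 1 - r)
  (fun t r => Normc.normc (f (polar r t))) 4 p q b (c + ln 9) _ p0 q0 b0 bq X0 C0) => //.
- by rewrite ln44; have := hc; have := ln9; have := pqb0; lra.
- by apply: le_pqb => //; rewrite lerDr ltW.
- exact: folds_angular.
- by apply: folds_radial; rewrite ler1n.
- move=> t r t2 r01 t0; rewrite normc_ge0 (addrC (Num.min _ _)) bound_le//.
  have /andP[r0 _] := (folds_radial (lexx 1)).1 r r01.
  by rewrite ltr_wpDl.
Qed.

Lemma angular_outer_log_power_y : b * q = 1 -> angular_outer f p q = +oo%E.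
Proof.
move=> bq; have c22 : ln 2 < c + 2 by have := c2; lra.
have pi1 := @pihalf_ge1 R.
apply: (@mixed_integral_infinite _ _ `]0, 1]%classic _ id (fun t => `[1 - t, 1[%classic)
  (fun t r => Normc.normc (f (polar r t))) p q b (c + 2) p0 q0 bq c22) => //.
- by move=> t /=; rewrite !in_itv/=; lra.
- move=> t /=; rewrite in_itv/= => /andP[t0 t1]; split.
  + exact: measurable_itv.
  + by move=> r /=; rewrite !in_itv/=; lra.
  + rewrite lebesgue_measure_itv/= lte_fin ifT; last by lra.
    by rewrite -EFinB lee_fin; lra.
- move=> t r /=; rewrite !in_itv/= => /andP[t0 t1] /andP[rt r1].
  by apply: bound_ge; lra.
Qed.

Lemma radial_outer_log_power_y : b * p = 1 -> radial_outer f q p = +oo%E.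
Proof.
move=> bp; have c22 : ln 2 < c + 2 by have := c2; lra.
have pi1 := @pihalf_ge1 R.
apply: (@mixed_integral_infinite _ _ `[0, 1[%classic _ (fun r => 1 - r)
  (fun r => `[0, 1 - r]%classic)
  (fun r t => Normc.normc (f (polar r t))) q p b (c + 2) q0 p0 bp c22) => //.
- by move=> r /=; rewrite in_itv/=; lra.
- move=> psi mpsi psi0; rewrite -(ge0_integral_reflection 1 _ mpsi psi0)//.
  apply: ge0_le_integral_subset => // r /=; rewrite !in_itv/=; lra.
- move=> r /=; rewrite in_itv/= => /andP[r0 r1]; split.
  + exact: measurable_itv.
  + by move=> t /=; rewrite !in_itv/=; lra.
  + rewrite lebesgue_measure_itv/= lte_fin ifT; last by lra.
    by rewrite -EFinB lee_fin; lra.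
- move=> r t /=; rewrite !in_itv/= (addrC q^-1) => /andP[r0 r1] /andP[t0 tr].
  by apply: bound_ge; lra.
Qed.

End log_power_norms.

(** * Choice of c and proof of the theorem *)

Lemma exists_log_constant (R : realType) (p q b : R) : 0 < p -> 0 < q ->
  exists c, ln 8 + 2 * (p + q) * b < c /\ b <= (p^-1 + q^-1) * (c - ln 2).
Proof.
move=> p0 q0; set a := p^-1 + q^-1.
have a0 : 0 < a by rewrite addr_gt0 ?invr_gt0.
pose c1 := ln 8 + 2 * (p + q) * b + 1; pose c2 := ln 2 + b / a.
exists (Num.max c1 c2); split; first by rewrite lt_max /c1 ltrDl ltr01.
rewrite mulrC -ler_pdivrMr// lerBrDl le_max /c2 lexx orbT//.
Qed.

Theorem theorem1p1 (R : realType) (p q : R) (hp : 1 < p) (hq : 1 < q) :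
  (q < p -> RM p q `<` Hmixed q p) /\ (p < q -> Hmixed q p `<` RM p q).
Proof.
have p0 : 0 < p by exact: lt_trans hp.
have q0 : 0 < q by exact: lt_trans hq.
have holo b c : ln 8 + 2 * (p + q) * b < c -> 0 <= b ->
    holomorphic_disc (log_power (p^-1 + q^-1) b c).
  move=> hc b0; apply: holomorphic_log_power; apply: le_lt_trans hc.
  have : ln 2 <= ln 8 :> R by rewrite ler_ln ?posrE// ler_nat.
  have : 0 <= 2 * (p + q) * b by rewrite mulr_ge0// mulr_ge0// ltW// addr_gt0.
  by lra.
split=> [qp|pq]; split.
- move=> f [hf fRM]; split=> //; apply/Hnorm_ltyP => //.
  have qp' : 0 < q < p by rewrite q0.
  apply: (le_lt_trans (radial_outer_le hf qp')).
  by apply: poweR_lty; apply/rho_ltyP.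
- have b0 : 0 <= q^-1 by rewrite invr_ge0 ltW.
  have [c [hc hbc]] := exists_log_constant q^-1 p0 q0.
  have hf := holo _ _ hc b0.
  move=> /(_ (log_power (p^-1 + q^-1) q^-1 c)) [].
    split=> //; apply/Hnorm_ltyP => //.
    by apply: radial_outer_log_power_lty => //; rewrite ltr_pdivlMl// mulr1.
  move=> _ /rho_ltyP => /(_ p0 q0).
  by rewrite angular_outer_log_power_y// mulVf// gt_eqF.
- move=> f [hf fH]; split=> //; apply/rho_ltyP => //.
  have pq' : 0 < p < q by rewrite p0.
  apply: (le_lt_trans (angular_outer_le hf pq')).
  by apply: poweR_lty; apply/Hnorm_ltyP.
- have b0 : 0 <= p^-1 by rewrite invr_ge0 ltW.
  have [c [hc hbc]] := exists_log_constant p^-1 p0 q0.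
  have hf := holo _ _ hc b0.
  move=> /(_ (log_power (p^-1 + q^-1) p^-1 c)) [].
    split=> //; apply/rho_ltyP => //.
    by apply: angular_outer_log_power_lty => //; rewrite ltr_pdivlMl// mulr1.
  move=> _ /Hnorm_ltyP => /(_ p0 q0 hf).
  by rewrite radial_outer_log_power_y// mulVf// gt_eqF.
Qed.
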